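(* Let $M$ be a smooth manifold with a smooth (semi-)Riemannian metric $g_{ab}$ satisfying the vacuum Einstein equations with cosmological constant, $R_{ab}=\lambda g_{ab}$, where $\lambda$ is a constant. Let $\mathcal{K}:\Lambda^1\to\bigodot^2\Lambda^1$ be the Killing operator $X_b\mapsto\nabla_{(a}X_{b)}$ and let $\mathcal{P}:\bigodot^2\Lambda^1\to\bigodot^2\Lambda^1$ be the second order linear differential operator $h_{ab}\mapsto g^{ac}(\mathcal{C}h)_{abcd}$, where $\mathcal{C}$ is the Calabi operator of $g_{ab}$. Then: (i) the sequence $$\textstyle\Lambda^1\xrightarrow{\ \mathcal{K}\ }\bigodot^2\Lambda^1\xrightarrow{\ \mathcal{P}\ }\bigodot^2\Lambda^1$$ is a complex, i.e. $\mathcal{P}\circ\mathcal{K}=0$; (ii) the kernel of $\mathcal{P}$ consists precisely of those smooth symmetric tensors $h_{ab}$ such that $\widetilde g_{ab}=g_{ab}+\epsilon h_{ab}$ satisfies the vacuum Einstein equations $\widetilde R_{ab}=\lambda\widetilde g_{ab}$ (with the same constant $\lambda$) to first order in $\epsilon$, i.e. $\widetilde R_{ab}-\lambda\widetilde g_{ab}=\mathrm{O}(\epsilon^2)$; (iii) the range of $\mathcal{K}$ consists precisely of those $h_{ab}$ arising from infinitesimal changes of coordinates, i.e. those of the form $h_{ab}=\mathcal{L}_Yg_{ab}$ for some smooth vector field $Y^a$, where $\mathcal{L}_Y$ denotes the Lie derivative along $Y^a$.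
   Context: Everything is smooth and indices are abstract indices. Round brackets on indices denote symmetrisation and square brackets skew-symmetrisation, each with the factor $\frac12$ for two indices: $T_{(ab)}=\frac12(T_{ab}+T_{ba})$, $T_{[ab]}=\frac12(T_{ab}-T_{ba})$; in particular $\nabla_{(a}\nabla_{c)}=\frac12(\nabla_a\nabla_c+\nabla_c\nabla_a)$. $\Lambda^1$ is the cotangent bundle and $\bigodot^2\Lambda^1$ the bundle of symmetric covariant $2$-tensors; differential operators act on smooth sections. $\nabla_a$ is the Levi-Civita connection of $g_{ab}$, and its curvature is defined by $(\nabla_a\nabla_b-\nabla_b\nabla_a)X^c=R_{ab}{}^c{}_dX^d$ for all vector fields $X^c$. Indices are raised and lowered with $g_{ab}$, so $R_{abcd}=g_{ce}R_{ab}{}^e{}_d$; the Ricci tensor is $R_{bd}=g^{ac}R_{abcd}=R_{ab}{}^a{}_d$. The Calabi operator $\mathcal{C}$ sends a symmetric tensor $h_{ab}$ to the tensor $$(\mathcal{C}h)_{abcd}=\nabla_{(a}\nabla_{c)}h_{bd}-\nabla_{(b}\nabla_{c)}h_{ad}-\nabla_{(a}\nabla_{d)}h_{bc}+\nabla_{(b}\nabla_{d)}h_{ac}-R_{ab}{}^e{}_{[c}h_{d]e}-R_{cd}{}^e{}_{[a}h_{b]e}.$$ For fixed $h_{ab}$, $\widetilde g_{ab}=g_{ab}+\epsilon h_{ab}$ is (locally) non-degenerate for $\epsilon$ sufficiently small; $\widetilde R_{ab}$ denotes its Ricci tensor (same conventions, using the Levi-Civita connection of $\widetilde g_{ab}$).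 $\mathrm{O}(\epsilon^2)$ is understood locally on $M$ as $\epsilon\to0$. *)

(* Defs.v *)
From HB Require Import structures.
From mathcomp Require Import all_boot all_order all_algebra.
From mathcomp Require Import all_classical all_reals all_analysis.
Import Order.TTheory GRing.Theory Num.Theory.
Import numFieldNormedType.Exports.

Set Implicit Arguments.
Unset Strict Implicit.
Unset Printing Implicit Defensive.

Local Open Scope classical_set_scope.
Local Open Scope ring_scope.

(* Tensor calculus on an open subset of R^n.  A tensor field is given by its
   components in the coordinate frame, indices first and the point last, so
   that e.g. [h a b : 'rV[R]_n -> R] is a scalar function.  Derivative indices
   come first: [nabla_cov2 g h a b c] is nabla_a h_bc. *)
Section coordinate_calculus.
Variables (R : realType) (n : nat).
Implicit Types (a b c d e : 'I_n) (x : 'rV[R]_n) (U : set 'rV[R]_n).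

Definition pd a (f : 'rV[R]_n -> R) : 'rV[R]_n -> R := fun x => 'D_('e_a) f x.

Fixpoint Ck (k : nat) U (f : 'rV[R]_n -> R) : Prop :=
  (forall x, U x -> {for x, continuous f}) /\
  (if k is k'.+1 then
     forall a, (forall x, U x -> derivable f x 'e_a) /\ Ck k' U (pd a f)
   else True).

(* Meant for open [U]. *)
Definition smooth_on U (f : 'rV[R]_n -> R) : Prop := forall k, Ck k U f.

Definition comp1 := 'I_n -> 'rV[R]_n -> R.
Definition comp2 := 'I_n -> 'I_n -> 'rV[R]_n -> R.
Definition comp3 := 'I_n -> 'I_n -> 'I_n -> 'rV[R]_n -> R.
Definition comp4 := 'I_n -> 'I_n -> 'I_n -> 'I_n -> 'rV[R]_n -> R.

Implicit Types g h : comp2.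

Definition gram g x : 'M[R]_n := \matrix_(a, b) g a b x.

(* g^{ab}; only meaningful where [gram g x] is invertible. *)
Definition ginv g : comp2 := fun a b x => invmx (gram g x) a b.

(* [christoffel g c a b] is Gamma^c_{ab} of the Levi-Civita connection. *)
Definition christoffel g : comp3 := fun c a b x =>
  2^-1 * \sum_d ginv g c d x *
    (pd a (g b d) x + pd b (g a d) x - pd d (g a b) x).

(* nabla_a X^c *)
Definition nabla_vect g (X : comp1) : comp2 := fun a c x =>
  pd a (X c) x + \sum_e christoffel g c a e x * X e x.

(* nabla_a T_b^c *)
Definition nabla_mixed g (T : comp2) : comp3 := fun a b c x =>
  pd a (T b c) x - \sum_e christoffel g e a b x * T e c x
                 + \sum_e christoffel g c a e x * T b e x.

Definition nabla_cov1 g (X : comp1) : comp2 := fun a b x =>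
  pd a (X b) x - \sum_e christoffel g e a b x * X e x.

Definition nabla_cov2 g (T : comp2) : comp3 := fun a b c x =>
  pd a (T b c) x - \sum_e christoffel g e a b x * T e c x
                 - \sum_e christoffel g e a c x * T b e x.

Definition nabla_cov3 g (T : comp3) : comp4 := fun a b c d x =>
  pd a (T b c d) x - \sum_e christoffel g e a b x * T e c d x
                   - \sum_e christoffel g e a c x * T b e d x
                   - \sum_e christoffel g e a d x * T b c e x.

Definition coord_vect d : comp1 := fun c _ => (c == d)%:R.

(* [riemann g a b c d] is R_{ab}^c_d.  As
   (nabla_a nabla_b - nabla_b nabla_a) X^c = R_{ab}^c_e X^e is tensorial in X,
   its value on the coordinate vector field X = d/dx^d is R_{ab}^c_d. *)
Definition riemann g : comp4 := fun a b c d x =>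
  nabla_mixed g (nabla_vect g (coord_vect d)) a b c x -
  nabla_mixed g (nabla_vect g (coord_vect d)) b a c x.

Definition ricci g : comp2 := fun b d x => \sum_a riemann g a b a d x.

Definition killing g (X : comp1) : comp2 := fun a b x =>
  2^-1 * (nabla_cov1 g X a b x + nabla_cov1 g X b a x).

(* [hess_sym g h a c b d] is nabla_(a nabla_c) h_bd. *)
Definition hess_sym g h : comp4 := fun a c b d x =>
  2^-1 * (nabla_cov3 g (nabla_cov2 g h) a c b d x +
          nabla_cov3 g (nabla_cov2 g h) c a b d x).

(* [riemann_skew g h a b c d] is R_{ab}^e_[c h_d]e. *)
Definition riemann_skew g h : comp4 := fun a b c d x =>
  2^-1 * (\sum_e riemann g a b e c x * h d e x -
          \sum_e riemann g a b e d x * h c e x).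

Definition calabi g h : comp4 := fun a b c d x =>
  hess_sym g h a c b d x - hess_sym g h b c a d x
  - hess_sym g h a d b c x + hess_sym g h b d a c x
  - riemann_skew g h a b c d x - riemann_skew g h c d a b x.

Definition calabi_trace g h : comp2 := fun b d x =>
  \sum_a \sum_c ginv g a c x * calabi g h a b c d x.

(* (L_Y g)_ab *)
Definition lie_deriv (Y : comp1) g : comp2 := fun a b x =>
  \sum_c (Y c x * pd c (g a b) x + g c b x * pd a (Y c) x
                                 + g a c x * pd b (Y c) x).

Definition perturb g h (eps : R) : comp2 := fun a b x => g a b x + eps * h a b x.

End coordinate_calculus.

Section manifold.
Variables (R : realType) (n : nat) (M : topologicalType).

Record chart := Chart {
  source : set M ;
  chart_map :> M -> 'rV[R]_n ;
  chart_inv : 'rV[R]_n -> M ;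
  chart_source_open : open source ;
  chart_target_open : open (chart_map @` source) ;
  chart_mapK : forall p, source p -> chart_inv (chart_map p) = p ;
  chart_map_continuous : forall p, source p -> {for p, continuous chart_map} ;
  chart_inv_continuous :
    forall x, (chart_map @` source) x -> {for x, continuous chart_inv}
}.

Implicit Types c d : chart.

Definition target c : set 'rV[R]_n := c @` source c.

Definition transition c d (x : 'rV[R]_n) : 'rV[R]_n := d (chart_inv c x).

Definition overlap c d : set 'rV[R]_n :=
  [set x | target c x /\ source d (chart_inv c x)].

(* Not required to be maximal. *)
Record smooth_atlas := SmoothAtlas {
  charts : set chart ;
  charts_cover : forall p : M, exists2 c, charts c & source c p ;
  charts_compatible : forall c d, charts c -> charts d ->
    forall b, smooth_on (overlap c d) (fun x => transition c d x 0 b)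
}.

(* [jac c d a b] is the derivative of the b-th coordinate of [d] along the a-th
   coordinate of [c], as a function of the coordinates of [c]. *)
Definition jac c d : comp2 R n := fun a b =>
  pd a (fun x => transition c d x 0 b).

Definition field1 := chart -> comp1 R n.
Definition field2 := chart -> comp2 R n.

Variable A : smooth_atlas.

Definition vector_field (Y : field1) : Prop :=
  (forall c, charts A c -> forall a, smooth_on (target c) (Y c a)) /\
  (forall c d, charts A c -> charts A d -> forall b x, overlap c d x ->
     Y d b (transition c d x) = \sum_a Y c a x * jac c d a b x).

Definition covector_field (X : field1) : Prop :=
  (forall c, charts A c -> forall a, smooth_on (target c) (X c a)) /\
  (forall c d, charts A c -> charts A d -> forall a x, overlap c d x ->
     X c a x = \sum_b jac c d a b x * X d b (transition c d x)).

Definition sym2_field (h : field2) : Prop :=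
  [/\ forall c, charts A c -> forall a b, smooth_on (target c) (h c a b),
      forall c, charts A c -> forall a b x, target c x -> h c a b x = h c b a x
    & forall c d, charts A c -> charts A d -> forall a b x, overlap c d x ->
        h c a b x = \sum_a' \sum_b' jac c d a a' x * jac c d b b' x *
                      h d a' b' (transition c d x)].

(* No condition on the signature. *)
Definition semi_riemannian (g : field2) : Prop :=
  sym2_field g /\
  forall c, charts A c -> forall x, target c x -> gram (g c) x \in unitmx.

(* Values of component functions off the target of the chart are junk. *)
Definition eq_field2 (h k : field2) : Prop :=
  forall c, charts A c -> forall a b x, target c x -> h c a b x = k c a b x.

Definition zero_field2 : field2 := fun _ _ _ _ => 0.

Definition killing_op (g : field2) (X : field1) : field2 :=
  fun c => killing (g c) (X c).

Definition P_op (g h : field2) : field2 := fun c => calabi_trace (g c) (h c).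

Definition lie_op (Y : field1) (g : field2) : field2 :=
  fun c => lie_deriv (Y c) (g c).

Definition einstein (g : field2) (lam : R) : Prop :=
  eq_field2 (fun c => ricci (g c)) (fun c a b x => lam * g c a b x).

(* The bound is required of the components in every chart, uniformly near every
   point; this does not depend on the charts. *)
Definition einstein_to_first_order (g h : field2) (lam : R) : Prop :=
  forall c, charts A c -> forall x0, target c x0 -> forall a b,
  exists C : R, \forall x \near x0 & eps \near (0 : R),
    let gt := perturb (g c) (h c) eps in
    gram gt x \in unitmx /\
    `|ricci gt a b x - lam * gt a b x| <= C * eps ^+ 2.

End manifold.

(* Main.v *)
From HB Require Import structures.
Require Import Defs.
From mathcomp Require Import all_boot all_order all_algebra.
From mathcomp Require Import all_classical all_reals all_analysis.
From mathcomp Require Import ring lra.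
Import Order.TTheory GRing.Theory Num.Theory.
Import numFieldNormedType.Exports.

(** Everything in the statement is local, so the proof works with component
functions on an open subset U of R^n and meets the atlas only at the end.

The tensors are stored as matrix-valued functions.  [gram h x] is the matrix of
h, and [conn g a x] is the matrix of Gamma^c_{ab} with row b and column c.  A
derivative index is thus a parameter, and the tensor indices are handled by
matrix algebra: with G_a = [conn g a],
  nabla_a T = d_a T - G_a T - T G_a^T  ([covd]),
and the curvature is d_a G_b - d_b G_a - [G_a, G_b]  ([curv]).  Identities
between covariant derivatives become identities between words in finitely many
non-commuting letters.

The pivot is the linearised Ricci operator.  For symmetric h let
  S_{b;cd} = (nabla_b h_cd + nabla_c h_bd - nabla_d h_bc) / 2  ([dconn_low]),
the lowered first variation of the connection, and let
  dricci h_bd = g^{ac} (nabla_a S_{b;dc} - nabla_b S_{a;dc})  ([dricci]).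
Commuting derivatives in the trace of the Calabi operator and using
R_ab = lam g_ab gives P h = - 2 (dricci h - lam h) ([calabi_trace_dricci]), and
the three parts follow from properties of dricci.

(ii) The connection of g + eps h differs from that of g by eps S (g + eps h)^-1.
Hence Ric(g + eps h) = Ric(g) + eps dricci h + eps^2 Q with an explicit Q
([ricci_perturb]), continuous in (x, eps) near (x0, 0) and so locally bounded
([ricci_remainder]).  The first-order Einstein equation therefore says exactly
that dricci h = lam h ([einstein_first_order_dricci]).

(i) Let h = L_Y g.  The Lie derivative L_Y Gamma of the connection is a tensor
whose lowered form solves the equations that determine S ([lie_conn_gram]), and
its antisymmetrised covariant derivative is the Lie derivative of the curvature
([lie_curvature]).  Taking the trace, dricci (L_Y g) = L_Y Ric = lam L_Y g
([dricci_lie_einstein]).  Every covector field X has nabla_(a X_b) = L_Y g_ab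
for Y = X^# / 2 ([killing_lie]), so P kills the range of the Killing operator.
That P h is again a tensor holds because G, then S, then the derivatives of S
transform as they should ([conn_pullback], [dricci_pullback]).

(iii) This is [killing_lie] together with the fact that raising and lowering an
index are inverse operations on smooth fields.

One algebraic fact, [koszul_unique], is used for the transformation law of the
connection, for its perturbation and for its Lie derivative: an array symmetric
in its first two indices is determined by its symmetrisation in the last two. *)

Set Implicit Arguments.
Unset Strict Implicit.
Unset Printing Implicit Defensive.

Local Open Scope classical_set_scope.
Local Open Scope ring_scope.

(** * Closure properties of smooth functions *)

Section smooth_functions.
Variables (R : realType) (n : nat).
Implicit Types (a b : 'I_n) (x : 'rV[R]_n) (U : set 'rV[R]_n).
Implicit Types f k : 'rV[R]_n -> R.

Lemma near_open U x (P : 'rV[R]_n -> Prop) :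
  open U -> U x -> (forall y, U y -> P y) -> \near x, P x.
Proof.
move=> oU Ux UP; apply: filterS (UP) _; exact: open_nbhs_nbhs.
Qed.

Lemma pd_ext U a f k x : open U -> U x -> (forall y, U y -> f y = k y) ->
  pd a f x = pd a k x.
Proof. by move=> oU Ux fk; apply/near_eq_derive/(near_open oU Ux fk). Qed.

Lemma continuous_ext U f k x : open U -> U x -> (forall y, U y -> f y = k y) ->
  {for x, continuous f} -> {for x, continuous k}.
Proof.
move=> oU Ux fk; rewrite /prop_for /continuous_at -(fk _ Ux) => cf.
refine (cvg_trans (near_eq_cvg _) cf).
by apply: (near_open oU Ux) => y Uy; rewrite fk.
Qed.

Lemma Ck_ext m U f k : open U -> (forall y, U y -> f y = k y) ->
  Ck m U f -> Ck m U k.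
Proof.
move=> oU; elim: m f k => [|m IH] f k fk [cf df]; split => //.
- by move=> x Ux; apply: (continuous_ext oU Ux fk); exact: cf.
- by move=> x Ux; apply: (continuous_ext oU Ux fk); exact: cf.
- move=> a; have [dfa Cfa] := df a; split.
    by move=> x Ux; apply: near_eq_derivable (dfa _ Ux);
        exact: near_open oU Ux _.
  by apply: IH Cfa => y Uy; exact: (pd_ext _ oU).
Qed.

Lemma smooth_ext U f k : open U -> (forall y, U y -> f y = k y) ->
  smooth_on U f -> smooth_on U k.
Proof. by move=> oU fk sf m; apply: (Ck_ext oU fk). Qed.

Lemma CkS m U f : Ck m.+1 U f -> Ck m U f.
Proof.
elim: m f => [|m IH] f [cf df]; split => // a.
by have [dfa Cfa] := df a; split => //; apply: IH.
Qed.

Lemma smooth_pd U a f : smooth_on U f -> smooth_on U (pd a f).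
Proof. by move=> sf m; have [_ /(_ a)[]] := sf m.+1. Qed.

Lemma smooth_derivable U a f x : smooth_on U f -> U x -> derivable f x 'e_a.
Proof. by move=> /(_ 1)[_ /(_ a)[df _]] /df. Qed.

Lemma smooth_continuous U f x : smooth_on U f -> U x -> {for x, continuous f}.
Proof. by move=> /(_ 0)[cf _] /cf. Qed.

Lemma smooth_sub U V f : V `<=` U -> smooth_on U f -> smooth_on V f.
Proof.
move=> VU sf m; move: (sf m); elim: m f {sf} => [|m IH] f [cf df]; split => //;
  try by move=> x /VU/cf.
by move=> a; have [dfa /IH Cfa] := df a; split => // x /VU/dfa.
Qed.

Lemma pd_cst a (c : R) x : pd a (fun=> c) x = 0.
Proof. exact: derive_cst. Qed.

Lemma pdD a f k x : derivable f x 'e_a -> derivable k x 'e_a ->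
  pd a (fun y => f y + k y) x = pd a f x + pd a k x.
Proof. exact: deriveD. Qed.

Lemma pdN a f x : derivable f x 'e_a ->
  pd a (fun y => - f y) x = - pd a f x.
Proof. exact: deriveN. Qed.

Lemma pdM a f k x : derivable f x 'e_a -> derivable k x 'e_a ->
  pd a (fun y => f y * k y) x = pd a f x * k x + f x * pd a k x.
Proof.
by move=> df dk; rewrite /pd (deriveM df dk) addrC /GRing.scale /= [k x *
    _]mulrC.
Qed.

Lemma Ck_cst m U (c : R) : open U -> Ck m U (fun=> c).
Proof.
move=> oU; elim: m c => [|m IH] c; split => //;
  try by move=> x _; exact: cst_continuous.
move=> a; split; first by move=> x _; exact: derivable_cst.
by apply: (Ck_ext oU _ (IH 0)) => y _; rewrite pd_cst.
Qed.

Lemma smooth_cst U (c : R) : open U -> smooth_on U (fun=> c).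
Proof. by move=> oU m; exact: Ck_cst. Qed.

Lemma CkD m U f k : open U -> Ck m U f -> Ck m U k ->
  Ck m U (fun y => f y + k y).
Proof.
move=> oU; elim: m f k => [|m IH] f k [cf df] [ck dk]; split => //;
  try by move=> x Ux; apply: continuousD; [exact: cf|exact: ck].
move=> a; have [dfa Cf] := df a; have [dka Cg] := dk a; split.
  by move=> x Ux; apply: derivableD; [exact: dfa|exact: dka].
by apply: (Ck_ext oU _ (IH _ _ Cf Cg)) => y Uy;
    rewrite (pdD (dfa _ Uy) (dka _ Uy)).
Qed.

Lemma CkM m U f k : open U -> Ck m U f -> Ck m U k ->
  Ck m U (fun y => f y * k y).
Proof.
move=> oU; elim: m f k => [|m IH] f k Cf Ck; have [cf df] := Cf;
    have [ck dk] := Ck;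
 split => //; try by move=> x Ux; apply: continuousM; [exact: cf|exact: ck].
move=> a; have [dfa Cfa] := df a; have [dka Cka] := dk a; split.
  by move=> x Ux; apply: derivableM; [exact: dfa|exact: dka].
have := CkD oU (IH _ _ Cfa (CkS Ck)) (IH _ _ (CkS Cf) Cka).
apply: (Ck_ext oU) => y Uy; rewrite pdM//; [exact: dfa|exact: dka].
Qed.

Lemma smoothD U f k : open U -> smooth_on U f -> smooth_on U k ->
  smooth_on U (fun y => f y + k y).
Proof. by move=> oU sf sk m; exact: CkD. Qed.

Lemma smoothM U f k : open U -> smooth_on U f -> smooth_on U k ->
  smooth_on U (fun y => f y * k y).
Proof. by move=> oU sf sk m; exact: CkM. Qed.

Lemma smoothN U f : open U -> smooth_on U f -> smooth_on U (fun y => - f y).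
Proof.
move=> oU sf; have := smoothM oU (smooth_cst (-1) oU) sf.
by apply: smooth_ext => // y _; rewrite mulN1r.
Qed.

Lemma Ck_sum m U (I : Type) (r : seq I) (P : pred I) (F : I -> 'rV[R]_n -> R) :
  open U -> (forall i, Ck m U (F i)) ->
  Ck m U (fun y => \sum_(i <- r | P i) F i y).
Proof.
move=> oU sF; elim: r => [|i r IH].
  by have := Ck_cst m 0 oU; apply: Ck_ext => // y _; rewrite big_nil.
apply: (@Ck_ext m U (fun y => (if P i then F i y else 0) + \sum_(j <- r | P j)
    F j y)) => //.
  by move=> y _; rewrite big_cons; case: (P i); rewrite ?add0r.
by apply: CkD => //; case: (P i); [exact: sF|exact: Ck_cst].
Qed.

Lemma smooth_sum U (I : Type) (r : seq I) (P : pred I) (F : I -> 'rV[R]_n ->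
    R) :
  open U -> (forall i, smooth_on U (F i)) ->
  smooth_on U (fun y => \sum_(i <- r | P i) F i y).
Proof. by move=> oU sF m; apply: Ck_sum => // i; exact: sF. Qed.

Lemma smooth_prod U (I : Type) (r : seq I) (P : pred I) (F : I ->
    'rV[R]_n -> R) :
  open U -> (forall i, smooth_on U (F i)) ->
  smooth_on U (fun y => \prod_(i <- r | P i) F i y).
Proof.
move=> oU sF; elim: r => [|i r IH].
  by have := smooth_cst 1 oU; apply: smooth_ext => // y _; rewrite big_nil.
apply: (@smooth_ext U (fun y => (if P i then F i y else 1) * \prod_(j <- r | P
    j) F j y)) => //.
  by move=> y _; rewrite big_cons; case: (P i); rewrite ?mul1r.
by apply: smoothM => //; case: (P i); [exact: sF|exact: smooth_cst].
Qed.

Lemma CkV m U f : open U -> (forall y, U y -> f y != 0) -> Ck m U f ->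
  Ck m U (fun y => (f y)^-1).
Proof.
move=> oU f0; elim: m => [|m IH] Cf; have [cf df] := Cf; split => //;
  try by move=> x Ux; apply: continuousV; [exact: f0|exact: cf].
move=> a; have [dfa Cfa] := df a; split.
  by move=> x Ux; apply: derivableV; [exact: f0|exact: dfa].
have CV := IH (CkS Cf).
have := CkM oU (Ck_cst m (-1) oU) (CkM oU (CkM oU CV CV) Cfa).
apply: (Ck_ext oU) => y Uy.
rewrite /pd -[RHS]/('D_'e_a (fun y => (f y)^-1) y) (deriveV (f0 _ Uy) (dfa _
    Uy)).
by rewrite mulN1r -expr2 -exprVn scaleNr.
Qed.

Lemma smoothV U f : open U -> (forall y, U y -> f y != 0) -> smooth_on U f ->
  smooth_on U (fun y => (f y)^-1).
Proof. by move=> oU f0 sf m; exact: CkV. Qed.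

Lemma pd_sum (I : Type) (r : seq I) (P : pred I) (F : I -> 'rV[R]_n -> R) a x :
  (forall i, derivable (F i) x 'e_a) ->
  pd a (fun y => \sum_(i <- r | P i) F i y) x =
      \sum_(i <- r | P i) pd a (F i) x.
Proof.
move=> dF; suff [//] : derivable (fun y => \sum_(i <- r | P i) F i y) x 'e_a /\
  pd a (fun y => \sum_(i <- r | P i) F i y) x =
      \sum_(i <- r | P i) pd a (F i) x.
elim: r => [|i r [dr IH]].
  rewrite big_nil (_ : (fun _ => _) = fun=> 0).
    by split; [exact: derivable_cst|exact: pd_cst].
  by apply/funext => y; rewrite big_nil.
rewrite (_ : (fun _ => _) = fun y => (if P i then F i y else 0) + \sum_(j <- r
    | P j) F j y).
  have di : derivable (fun y => if P i then F i y else 0) x 'e_a.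
    by case: (P i); [exact: dF|exact: derivable_cst].
  split; first exact: derivableD.
  rewrite (pdD di dr) IH big_cons; case: (P i) => //.
  by rewrite pd_cst add0r.
by apply/funext => y; rewrite big_cons; case: (P i); rewrite ?add0r.
Qed.

End smooth_functions.

(** * Mean values, symmetry of second derivatives, the chain rule *)

Section partial_derivatives.
Variables (R : realType) (n : nat).
Implicit Types (a b : 'I_n) (x y p : 'rV[R]_n) (U : set 'rV[R]_n).
Implicit Types f k : 'rV[R]_n -> R.

Lemma coord_le_norm p b : `|p 0 b| <= `|p|.
Proof.
rewrite [leRHS]/Num.Def.normr/= mx_normrE.
exact: (le_bigmax _ (fun ij : 'I_1 * 'I_n => `|p ij.1 ij.2|) (0, b)).
Qed.

Lemma norm_le_coord p (c : R) : 0 <= c -> (forall b, `|p 0 b| <= c) ->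
    `|p| <= c.
Proof.
move=> c0 pc; rewrite [leLHS]/Num.Def.normr/= mx_normrE.
by apply: bigmax_le => // -[i b] _ /=; rewrite (ord1 i).
Qed.

Lemma norm_delta a : `|'e_a : 'rV[R]_n| <= 1.
Proof.
apply: norm_le_coord => // b; rewrite !mxE eqxx /=.
by case: (b == a); rewrite ?normr1 ?normr0.
Qed.

Lemma pd_shift f a v x : pd a (fun y => f (v + y)) x = pd a f (v + x).
Proof.
rewrite /pd /derive; set g1 := fun h => h^-1 *: _; set g2 := fun h => h^-1 *: _.
suff -> : g1 = g2 by [].
by apply/funext => h; rewrite /g1 /g2 /= addrCA.
Qed.

Lemma derivable_shift f a v x :
  derivable f (v + x) 'e_a -> derivable (fun y => f (v + y)) x 'e_a.
Proof.
rewrite /derivable; set g1 := fun h => h^-1 *: _; set g2 := fun h => h^-1 *: _.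
suff -> : g1 = g2 by [].
by apply/funext => h; rewrite /g1 /g2 /= addrCA.
Qed.

Lemma is_derive_line f a x (s : R) : derivable f (s *: 'e_a + x) 'e_a ->
  is_derive s 1 (fun t : R => f (t *: 'e_a + x)) (pd a f (s *: 'e_a + x)).
Proof.
have E : (fun h : R => h^-1 *: (((fun t : R =>
    f (t *: 'e_a + x)) \o shift s) (h *: 1) -
             f (s *: 'e_a + x))) =
         (fun h : R => h^-1 *: ((f \o shift (s *: 'e_a + x)) (h *: 'e_a) - f (s
             *: 'e_a + x))).
  by apply/funext => h /=; rewrite [h *: 1]mulr1 scalerDl addrA.
move=> df; split; first by rewrite /derivable E.
by rewrite /derive E.
Qed.

Lemma mean_value_line f a x (t : R) :
  (forall s : R, `|s| <= `|t| -> derivable f (s *: 'e_a + x) 'e_a) ->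
  exists2 s, `|s| <= `|t| &
    f (t *: 'e_a + x) - f x = t * pd a f (s *: 'e_a + x).
Proof.
move=> df; pose F (s : R) := f (s *: 'e_a + x).
have dF (s : R) : `|s| <= `|t| -> is_derive s 1 F (pd a f (s *: 'e_a + x)).
  by move=> st; exact/is_derive_line/df.
have F0 : f x = F 0 by rewrite /F scale0r add0r.
have [t0|t0|->] := ltgtP t 0.
- have st (s : R) : s \in `[t, 0] -> `|s| <= `|t|.
    by rewrite in_itv /= => /andP[ts s0]; rewrite !ler0_norm ?lerN2// ltW.
  have [||s /st sin e] := @MVT_segment _ F (fun s =>
      pd a f (s *: 'e_a + x)) t 0 (ltW t0).
  + by move=> s sin; apply/dF/st; apply: subset_itv_oo_cc sin.
  + by apply: derivable_within_continuous => s /st /dF [].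
  exists s => //; rewrite F0 -[f (t *: _ + _)]/(F t); apply: oppr_inj.
  by rewrite opprB e sub0r mulrN mulrC.
- have st (s : R) : s \in `[0, t] -> `|s| <= `|t|.
    by rewrite in_itv /= => /andP[s0 ts]; rewrite !ger0_norm // ltW.
  have [||s /st sin e] := @MVT_segment _ F (fun s =>
      pd a f (s *: 'e_a + x)) 0 t (ltW t0).
  + by move=> s sin; apply/dF/st; apply: subset_itv_oo_cc sin.
  + by apply: derivable_within_continuous => s /st /dF [].
  exists s => //; rewrite F0 -[f (t *: _ + _)]/(F t).
  by rewrite e subr0 mulrC.
- by exists 0 => //; rewrite mul0r scale0r add0r subrr.
Qed.

(** Two applications of the mean value theorem, first in the direction a to the
difference in the direction b, then in the direction b. *)
Lemma second_difference f a b x (t : R) :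
  (forall p, `|p - x| <= `|t| + `|t| ->
     derivable f p 'e_a /\ derivable (pd a f) p 'e_b) ->
  exists2 p, `|p - x| <= `|t| + `|t| &
    f (t *: 'e_a + (t *: 'e_b + x)) - f (t *: 'e_a + x) - f (t *: 'e_b + x) + f
        x
    = t * (t * pd b (pd a f) p).
Proof.
have ne (s : R) c : `|s| <= `|t| -> `|s *: ('e_c : 'rV[R]_n)| <= `|t|.
  by move=> st; rewrite normrZ (le_trans (ler_pM _ _ st (norm_delta c)))//
      mulr1.
move=> df; pose k y := f (t *: 'e_b + y) - f y.
have dk (s : R) : `|s| <= `|t| -> derivable k (s *: 'e_a + x) 'e_a.
  move=> st; apply: derivableB; first apply: derivable_shift.
    apply: (df _ _).1; rewrite addrA addrK (le_trans (ler_normD _ _))//.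
    by rewrite lerD// ne.
  by apply: (df _ _).1; rewrite addrK (le_trans (ne _ _ st))// lerDl.
have [s st e1] := mean_value_line dk.
have [|u ut e2] := @mean_value_line (pd a f) b (s *: 'e_a + x) t.
  move=> u ut; apply: (df _ _).2; rewrite addrA addrK.
  by rewrite (le_trans (ler_normD _ _))// lerD// ne.
exists (u *: 'e_b + (s *: 'e_a + x)).
  by rewrite addrA addrK (le_trans (ler_normD _ _))// lerD// ne.
rewrite -e2 -pd_shift.
have -> : pd a (fun y => f (t *: 'e_b + y)) (s *: 'e_a + x) - pd a f (s *: 'e_a
    + x)
     = pd a k (s *: 'e_a + x).
  rewrite /k /pd -[RHS]/('D_'e_a ((fun y =>
      f (t *: 'e_b + y)) - f) _) deriveB//.
    apply: derivable_shift; apply: (df _ _).1.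
    by rewrite addrA addrK (le_trans (ler_normD _ _))// lerD// ne.
  by apply: (df _ _).1; rewrite addrK (le_trans (ne _ _ st))// lerDl.
rewrite -e1 /k [t *: 'e_b + (_ + _)]addrCA; ring.
Qed.

(** The second difference of f in the directions a and b does not depend on their
order, and after division by t^2 it is a value of either mixed derivative at a
point close to x. *)
Lemma pdC U f a b x : open U -> smooth_on U f -> U x ->
  pd a (pd b f) x = pd b (pd a f) x.
Proof.
move=> oU sf Ux; apply/eqP; rewrite -subr_eq0 -normr_le0;
    apply/ler_addgt0Pl => e e0.
rewrite addr0; have e2 : 0 < e / 2 by rewrite divr_gt0.
have cab := smooth_continuous (smooth_pd a (smooth_pd b sf)) Ux.
have cba := smooth_continuous (smooth_pd b (smooth_pd a sf)) Ux.
have near2 (F G : 'rV[R]_n -> R) : {for x, continuous F} -> {for x,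
    continuous G} ->
    \forall p \near x, [/\ U p, `|F x - F p| <= e / 2 & `|G x - G p| <= e / 2].
  move=> /cvgrPdist_le/(_ _ e2) cF /cvgrPdist_le/(_ _ e2) cG.
  near=> p; split; near: p => //; exact: open_nbhs_nbhs.
have := near2 _ _ cab cba.
move=> /nbhs_normP[r /= r0 rP].
have rP' p : `|p - x| <= `|r / 4| + `|r / 4| -> [/\ U p,
   `|pd a (pd b f) x - pd a (pd b f) p| <= e / 2 &
    `|pd b (pd a f) x - pd b (pd a f) p| <= e / 2].
  move=> pr; apply: rP; rewrite /= distrC (le_lt_trans pr)//.
  rewrite gtr0_norm ?divr_gt0//; lra.
(* The same second difference is r^2/16 times either mixed derivative, taken at
   two different points of the ball. *)
have [p /rP'[_ _ Pp] ep] := @second_difference f a b x (r / 4)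
   (fun p pr => let: And3 Up _ _ := rP' p pr in
      conj (smooth_derivable sf Up) (smooth_derivable (smooth_pd a sf) Up)).
have [q /rP'[_ Pq _] eq] := @second_difference f b a x (r / 4)
   (fun p pr => let: And3 Up _ _ := rP' p pr in
      conj (smooth_derivable sf Up) (smooth_derivable (smooth_pd b sf) Up)).
have E : pd b (pd a f) p = pd a (pd b f) q.
  have r4 : r / 4 != 0 by rewrite gt_eqF// divr_gt0.
  have e2E : r / 4 * (r / 4 * pd b (pd a f) p) =
      r / 4 * (r / 4 * pd a (pd b f) q).
    apply: etrans (esym ep) (etrans _ eq).
    by rewrite [r / 4 *: 'e_b + (_ + _)]addrCA [X in X + _]addrAC.
  exact: (mulfI r4 (mulfI r4 e2E)).
move: (pd a (pd b f)) (pd b (pd a f)) Pp Pq E =>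
    F G Pp Pq E {ep eq rP rP' near2 cab cba}.
rewrite (splitr e) -(subrKA (G p)) {1}E (le_trans (ler_normD _ _))//.
by rewrite lerD// distrC.
Unshelve. all: by end_near. Qed.

(** The increment of f is split along the path that changes one coordinate at a
time; this path stays in the box spanned by the two points. *)
Lemma mean_value_box f x y :
  (forall p b, `|p - x| <= `|y - x| -> derivable f p 'e_b) ->
  exists2 xi : 'I_n -> 'rV[R]_n, (forall b, `|xi b - x| <= `|y - x|) &
    f y - f x = \sum_b (y 0 b - x 0 b) * pd b f (xi b).
Proof.
move=> df; pose z (k : nat) : 'rV[R]_n := \row_b (if (b < k)%N then y 0 b else
    x 0 b).
have z0 : z 0 = x by apply/rowP => b; rewrite mxE.
have zn : z n = y by apply/rowP => b; rewrite mxE ltn_ord.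
have zS b : z b.+1 = (y 0 b - x 0 b) *: 'e_b + z b.
  apply/rowP => c; rewrite !mxE ltnS leq_eqVlt eqxx /= (inj_eq val_inj).
  case: eqVneq => [->|_] /=; first by rewrite ltnn mulr1 subrK.
  by rewrite mulr0 add0r.
have zP b (s : R) : `|s| <= `|y 0 b - x 0 b| -> `|s *: 'e_b + z b - x| <=
    `|y - x|.
  move=> sb; apply: norm_le_coord => // c; rewrite !mxE eqxx /=.
  have yx d : `|y 0 d - x 0 d| <= `|y - x|.
    by have := coord_le_norm (y - x) d; rewrite !mxE.
  case: eqVneq => [->|_] /=.
    by rewrite ltnn mulr1 addrK (le_trans sb).
  by rewrite mulr0 add0r; case: ifP => _; rewrite // subrr normr0.
have mv b : exists q : 'rV[R]_n, `|q - x| <= `|y - x| /\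
    f (z b.+1) - f (z b) = (y 0 b - x 0 b) * pd b f q.
  rewrite zS; have [|s sb e] := @mean_value_line f b (z b) (y 0 b - x 0 b).
    by move=> s sb; apply/df/zP.
  by exists (s *: 'e_b + z b); split => //; exact: zP.
(* One mean value point for each coordinate step of the polygonal path z. *)
have [xi xiP] := fin_all_exists mv.
exists xi => [b|]; first by have [] := xiP b.
rewrite -[in f y]zn -[in f x]z0 -(@telescope_sumr _ 0%N n (fun i : nat =>
    f (z i)) (leq0n n)) big_mkord; apply: eq_bigr => b _.
by have [] := xiP b.
Qed.

Lemma cvg_rowP (T : Type) (F : set_system T) (G : T -> 'rV[R]_n) y :
  Filter F -> (forall b, G t 0 b @[t --> F] --> y 0 b) -> G t @[t --> F] --> y.
Proof.
move=> FF Gy; apply/cvgrPdist_le => e e0; near=> t.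
apply: norm_le_coord (ltW e0) _ => b; rewrite !mxE; move: b.
near: t; apply: filter_forall => b.
by move/cvgrPdist_le : (Gy b) => /(_ _ e0).
Unshelve. all: by end_near. Qed.

Lemma cvg_sum_ord (T : Type) (F : set_system T) (G : 'I_n -> T ->
    R) (l : 'I_n -> R) :
  Filter F -> (forall b, G b t @[t --> F] --> l b) ->
  \sum_b G b t @[t --> F] --> \sum_b l b.
Proof. by move=> FF Gl; apply: cvg_big => //; exact: add_continuous. Qed.

(** Partial derivatives of f exist and are continuous, so the difference quotient
of the composition is written with [mean_value_box] as a sum of products, each of
whose factors converges. *)
Lemma derivable_pd_comp (V : set 'rV[R]_n) f (psi : 'rV[R]_n -> 'rV[R]_n) a x :
  open V -> smooth_on V f -> V (psi x) ->
  (forall b, derivable (fun y => psi y 0 b) x 'e_a) ->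
  derivable (fun y => f (psi y)) x 'e_a /\
  pd a (fun y => f (psi y)) x =
    \sum_b pd a (fun y => psi y 0 b) x * pd b f (psi x).
Proof.
move=> oV sf Vpx dpsi.
set q := fun h : R => h^-1 *: (f (psi (h *: 'e_a + x)) - f (psi x)).
set l := \sum_b _.
suff ql : q h @[h --> 0^'] --> l.
  by split; [apply/cvg_ex; exists l|exact: cvg_lim ql].
pose line (h : R) := psi (h *: 'e_a + x).
have cline : line h @[h --> 0^'] --> psi x.
  apply: cvg_rowP => b; have := dpsi b.
  move=> /derivable1P/derivable1_diffP/differentiable_continuous.
  rewrite /prop_for /continuous_at scale0r add0r => c.
  exact: cvg_within_filter c.
have /nbhs_normP[r /= r0 rV] : nbhs (psi x) V by exact: open_nbhs_nbhs.
have nball : \forall h \near 0^', `|line h - psi x| < r.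
  by move/cvgrPdist_lt : cline => /(_ _ r0); apply: filterS => h;
      rewrite distrC.
have ex h : exists xi : 'I_n -> 'rV[R]_n, `|line h - psi x| < r ->
   (forall b, `|xi b - psi x| <= `|line h - psi x|) /\
   f (line h) - f (psi x) = \sum_b (line h 0 b - psi x 0 b) * pd b f (xi b).
  have [hr|hr] := boolP (`|line h - psi x| < r); last first.
    by exists (fun=> 0).
  have [p b pr|xi x1 x2] := @mean_value_box f (psi x) (line h).
    apply: (smooth_derivable sf); apply: rV.
    by rewrite /= distrC (le_lt_trans pr).
  by exists xi => _.
have {ex}[xi xiP] := choice ex.
have cxi b : xi h b @[h --> 0^'] --> psi x.
  apply/cvgrPdist_le => e e0; near=> h.
  have /xiP[/(_ b) hb _] : `|line h - psi x| < r by near: h.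
  rewrite distrC (le_trans hb)// distrC; near: h.
  by move/cvgrPdist_le : cline => /(_ _ e0).
have : \sum_b (h^-1 * (line h 0 b - psi x 0 b)) * pd b f (xi h b) @[h --> 0^']
    --> l.
  apply: cvg_sum_ord => b; apply: cvgM; first exact: dpsi.
  apply: cvg_comp (cxi b) _.
  exact: (smooth_continuous (smooth_pd b sf) Vpx).
apply: cvg_trans; apply: near_eq_cvg; near=> h.
have /xiP[_ e] : `|line h - psi x| < r by near: h.
rewrite /q -/(line h) e scaler_sumr; apply: eq_bigr => b _.
by rewrite /GRing.scale /= mulrA.
Unshelve. all: by end_near. Qed.

Lemma smooth_comp U (V : set 'rV[R]_n) f (psi : 'rV[R]_n -> 'rV[R]_n) :
  open U -> open V -> smooth_on V f ->
  (forall b, smooth_on U (fun y => psi y 0 b)) ->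
  (forall x, U x -> V (psi x)) -> smooth_on U (fun y => f (psi y)).
Proof.
move=> oU oV sf spsi UV.
have cpsi x : U x -> {for x, continuous psi}.
  move=> Ux; have : psi y @[y --> x] --> psi x.
    by apply: (@cvg_rowP _ (nbhs x) psi (psi x) _) => b;
        exact: (smooth_continuous (spsi b) Ux).
  exact.
have cfpsi f' x : smooth_on V f' -> U x -> {for x, continuous (fun y =>
    f' (psi y))}.
  move=> sf' Ux; apply: continuous_comp; first exact: cpsi.
  exact: smooth_continuous sf' (UV _ Ux).
move=> m; elim: m f sf => [|m IH] f sf; split => //; try by move=> x;
    exact: cfpsi.
move=> a.
have D x (Ux : U x) := derivable_pd_comp (a := a) oV sf (UV _ Ux)
  (fun b => smooth_derivable (spsi b) Ux).
split => [x Ux|]; first exact: (D x Ux).1.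
have : Ck m U (fun x => \sum_b pd a (fun y => psi y 0 b) x * pd b f (psi x)).
  apply: Ck_sum => // b; apply: CkM => //; first exact: smooth_pd (spsi b) m.
  by apply: IH; exact: smooth_pd.
by apply: Ck_ext => // x Ux; rewrite (D x Ux).2.
Qed.

End partial_derivatives.

(** * Calculus of matrix-valued functions *)

(* Comparing two distinct partial derivatives up to conversion would unfold the
   limits that define them. *)
#[local] Opaque pd.

(** Locked, because the unifier would otherwise compare distinct derivatives by
unfolding them down to limits. *)
HB.lock Definition mpd (R : realType) (n p q : nat) (a : 'I_n)
    (F : 'rV[R]_n -> 'M[R]_(p, q)) (x : 'rV[R]_n) : 'M[R]_(p, q) :=
  \matrix_(i, j) pd a (fun y => F y i j) x.

Section matrix_calculus.
Variables (R : realType) (n : nat) (U : set 'rV[R]_n).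
Hypothesis oU : open U.
Implicit Types (a b : 'I_n) (x : 'rV[R]_n).

Definition msmooth p q (F : 'rV[R]_n -> 'M[R]_(p, q)) : Prop :=
  forall i j, smooth_on U (fun y => F y i j).

Lemma mpdE p q a (F : 'rV[R]_n -> 'M[R]_(p, q)) x i j :
  mpd a F x i j = pd a (fun y => F y i j) x.
Proof. by rewrite mpd.unlock mxE. Qed.

Lemma msmooth_ext p q (F G : 'rV[R]_n -> 'M[R]_(p, q)) :
  (forall y, U y -> F y = G y) -> msmooth F -> msmooth G.
Proof. by move=> FG sF i j; apply: smooth_ext (sF i j) => // y Uy;
    rewrite FG. Qed.

Lemma mpd_ext p q (F G : 'rV[R]_n -> 'M[R]_(p, q)) a x : U x ->
  (forall y, U y -> F y = G y) -> mpd a F x = mpd a G x.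
Proof.
move=> Ux FG; apply/matrixP => i j; rewrite !mpdE; apply: (pd_ext a oU Ux).
by move=> y Uy; rewrite FG.
Qed.

Lemma msmooth_derivable p q (F : 'rV[R]_n -> 'M[R]_(p, q)) a x i j :
  msmooth F -> U x -> derivable (fun y => F y i j) x 'e_a.
Proof. by move=> sF Ux; exact: smooth_derivable (sF i j) Ux. Qed.

Lemma msmooth_mpd p q (F : 'rV[R]_n -> 'M[R]_(p, q)) a :
  msmooth F -> msmooth (mpd a F).
Proof.
move=> sF i j; apply: smooth_ext (smooth_pd a (sF i j)) => // y _.
by rewrite mpdE.
Qed.

Lemma msmoothD p q (F G : 'rV[R]_n -> 'M[R]_(p, q)) :
  msmooth F -> msmooth G -> msmooth (fun y => F y + G y).
Proof.
move=> sF sG i j; apply: smooth_ext (smoothD oU (sF i j) (sG i j)) => // y _.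
by rewrite mxE.
Qed.

Lemma msmoothN p q (F : 'rV[R]_n -> 'M[R]_(p, q)) :
  msmooth F -> msmooth (fun y => - F y).
Proof.
by move=> sF i j; apply: smooth_ext (smoothN oU (sF i j)) => // y _;
    rewrite mxE.
Qed.

Lemma msmoothT p q (F : 'rV[R]_n -> 'M[R]_(p, q)) :
  msmooth F -> msmooth (fun y => (F y)^T).
Proof. by move=> sF i j; apply: smooth_ext (sF j i) => // y _; rewrite mxE. Qed.

Lemma msmoothZ p q (c : 'rV[R]_n -> R) (F : 'rV[R]_n -> 'M[R]_(p, q)) :
  smooth_on U c -> msmooth F -> msmooth (fun y => c y *: F y).
Proof.
move=> sc sF i j; apply: smooth_ext (smoothM oU sc (sF i j)) => // y _.
by rewrite mxE.
Qed.

Lemma msmooth_sum p q (I : Type) (r : seq I) (P : pred I)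
    (F : I -> 'rV[R]_n -> 'M[R]_(p, q)) :
  (forall i, msmooth (F i)) -> msmooth (fun y => \sum_(i <- r | P i) F i y).
Proof.
move=> sF i j.
apply: smooth_ext (smooth_sum r P oU (fun k => sF k i j)) => // y _.
by rewrite summxE.
Qed.

Lemma msmoothM p q r (F : 'rV[R]_n -> 'M[R]_(p, q))
    (G : 'rV[R]_n -> 'M[R]_(q, r)) :
  msmooth F -> msmooth G -> msmooth (fun y => F y *m G y).
Proof.
move=> sF sG i j; have : smooth_on U (fun y => \sum_k F y i k * G y k j).
  by apply: smooth_sum => // k; apply: smoothM.
by apply: smooth_ext => // y _; rewrite mxE.
Qed.

Lemma smooth_det p (F : 'rV[R]_n -> 'M[R]_p) :
  msmooth F -> smooth_on U (fun y => \det (F y)).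
Proof.
move=> sF; apply: smooth_sum => // s; apply: smoothM => //.
  exact: smooth_cst.
by apply: smooth_prod => // i; exact: sF.
Qed.

Lemma msmooth_inv p (F : 'rV[R]_n -> 'M[R]_p) :
  msmooth F -> (forall y, U y -> F y \in unitmx) ->
  msmooth (fun y => invmx (F y)).
Proof.
move=> sF uF; have : msmooth (fun y => (\det (F y))^-1 *: \adj (F y)).
  apply: msmoothZ.
    apply: smoothV => //; last exact: smooth_det.
    by move=> y /uF; rewrite unitmxE unitfE.
  move=> i j; have : smooth_on U (fun y => cofactor (F y) j i).
    apply: smoothM => //; first exact: smooth_cst.
    apply: smooth_det => k l; apply: smooth_ext (sF (lift j k) (lift i l)) =>
        // y _.
    by rewrite !mxE.
  by apply: smooth_ext => // y _; rewrite mxE.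
by apply: msmooth_ext => y /uF Fy; rewrite /invmx Fy.
Qed.

Lemma mpd_cst p q (c : 'M[R]_(p, q)) a x : mpd a (fun=> c) x = 0.
Proof. by apply/matrixP => i j; rewrite mpdE mxE pd_cst. Qed.

Lemma mpdD p q (F G : 'rV[R]_n -> 'M[R]_(p, q)) a x : U x ->
  msmooth F -> msmooth G ->
  mpd a (fun y => F y + G y) x = mpd a F x + mpd a G x.
Proof.
move=> Ux sF sG; apply/matrixP => i j; rewrite mpdE mxE !mpdE -pdD;
    last 2 first.
- exact: msmooth_derivable sF Ux.
- exact: msmooth_derivable sG Ux.
by apply: (pd_ext a oU Ux) => y _; rewrite mxE.
Qed.

Lemma mpdZ p q (c : 'rV[R]_n -> R) (F : 'rV[R]_n -> 'M[R]_(p, q)) a x : U x ->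
  smooth_on U c -> msmooth F ->
  mpd a (fun y => c y *: F y) x = pd a c x *: F x + c x *: mpd a F x.
Proof.
move=> Ux sc sF; apply/matrixP => i j; rewrite mpdE 3!mxE mpdE -pdM;
    last 2 first.
- exact: smooth_derivable sc Ux.
- exact: msmooth_derivable sF Ux.
by apply: (pd_ext a oU Ux) => y _; rewrite mxE.
Qed.

Lemma mpdZc p q (c : R) (F : 'rV[R]_n -> 'M[R]_(p, q)) a x : U x ->
  msmooth F -> mpd a (fun y => c *: F y) x = c *: mpd a F x.
Proof.
move=> Ux sF; rewrite (mpdZ _ Ux (smooth_cst c oU) sF).
by rewrite pd_cst scale0r add0r.
Qed.

Lemma mpdN p q (F : 'rV[R]_n -> 'M[R]_(p, q)) a x : U x -> msmooth F ->
  mpd a (fun y => - F y) x = - mpd a F x.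
Proof.
move=> Ux sF; rewrite -scaleN1r -(mpdZc _ _ Ux sF).
by apply: mpd_ext => // y _; rewrite scaleN1r.
Qed.

Lemma mpdB p q (F G : 'rV[R]_n -> 'M[R]_(p, q)) a x : U x ->
  msmooth F -> msmooth G ->
  mpd a (fun y => F y - G y) x = mpd a F x - mpd a G x.
Proof. by move=> Ux sF sG; rewrite mpdD ?mpdN//; exact: msmoothN. Qed.

Lemma mpdT p q (F : 'rV[R]_n -> 'M[R]_(p, q)) a x : U x ->
  mpd a (fun y => (F y)^T) x = (mpd a F x)^T.
Proof.
move=> Ux; apply/matrixP => i j; rewrite mpdE mxE mpdE.
by apply: (pd_ext a oU Ux) => y _; rewrite mxE.
Qed.

Lemma mpd_sum p q (I : Type) (r : seq I) (P : pred I)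
    (F : I -> 'rV[R]_n -> 'M[R]_(p, q)) a x : U x ->
  (forall i, msmooth (F i)) ->
  mpd a (fun y => \sum_(i <- r | P i) F i y) x =
  \sum_(i <- r | P i) mpd a (F i) x.
Proof.
move=> Ux sF; apply/matrixP => i j; rewrite summxE mpdE.
under [RHS]eq_bigr do rewrite mpdE.
rewrite -pd_sum; last by move=> k; exact: msmooth_derivable (sF k) Ux.
by apply: (pd_ext a oU Ux) => y _; rewrite summxE.
Qed.

Lemma mpdM p q r (F : 'rV[R]_n -> 'M[R]_(p, q))
    (G : 'rV[R]_n -> 'M[R]_(q, r)) a x : U x -> msmooth F -> msmooth G ->
  mpd a (fun y => F y *m G y) x = mpd a F x *m G x + F x *m mpd a G x.
Proof.
move=> Ux sF sG; apply/matrixP => i j; rewrite mpdE 3!mxE.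
rewrite (pd_ext (k := fun y => \sum_k F y i k * G y k j) a oU Ux); last first.
  by move=> y _; rewrite mxE.
rewrite pd_sum; last first.
  move=> k; apply: derivableM; first exact: msmooth_derivable sF Ux.
  exact: msmooth_derivable sG Ux.
rewrite -big_split; apply: eq_bigr => k _; rewrite pdM ?mpdE//.
- exact: msmooth_derivable sF Ux.
- exact: msmooth_derivable sG Ux.
Qed.

Lemma mpdC p q (F : 'rV[R]_n -> 'M[R]_(p, q)) a b x : U x -> msmooth F ->
  mpd a (mpd b F) x = mpd b (mpd a F) x.
Proof.
move=> Ux sF; apply/matrixP => i j; rewrite !mpdE.
have E c : (fun y => mpd c F y i j) = pd c (fun y => F y i j).
  by apply/funext => y; rewrite mpdE.
rewrite !E; exact: (pdC a b oU (sF i j) Ux).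
Qed.

End matrix_calculus.

(** * Connections in matrix form *)

Section transpose.
Variables (R : realType) (p q : nat).
Implicit Types (X Y : 'M[R]_(p, q)).

Lemma trmxD X Y : (X + Y)^T = X^T + Y^T.
Proof. by apply/matrixP => i j; rewrite !mxE. Qed.

Lemma trmxN X : (- X)^T = - X^T.
Proof. by apply/matrixP => i j; rewrite !mxE. Qed.

Lemma trmxZ (c : R) X : (c *: X)^T = c *: X^T.
Proof. by apply/matrixP => i j; rewrite !mxE. Qed.

End transpose.

Ltac mx_normalize :=
  rewrite ?(trmxD, trmxN, trmxZ, trmx_mul, trmxK);
  rewrite ?(mulmxDl, mulmxDr, mulNmx, mulmxN, mulmxA);
  rewrite -?scalemxAl -?scalemxAr ?mulmxA.

Ltac mx_abstract :=
  repeat match goal with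
  | |- context [@mulmx ?R ?m ?n ?p ?A ?B] =>
      let X := fresh "X" in move: (@mulmx R m n p A B); intro X
  | |- context [@mpd ?R ?n ?p ?q ?a ?F ?x] =>
      let X := fresh "X" in move: (@mpd R n p q a F x); intro X
  end.

Ltac mx_linear :=
  mx_abstract; let i := fresh "i" in let j := fresh "j" in
  apply/matrixP => i j; rewrite !mxE; ring.

(** Decides identities between sums of matrix products: products are expanded and
left-associated, each maximal product becomes an atom, and the remaining linear
identity is checked entrywise. *)
Ltac mx_ring := mx_normalize; mx_linear.

Section connections.
Variables (R : realType) (n : nat) (U : set 'rV[R]_n).
Hypothesis oU : open U.
Implicit Types (a b c : 'I_n) (x : 'rV[R]_n).
Local Notation mfield := ('rV[R]_n -> 'M[R]_n).

(** The covariant derivative of a covariant 2-tensor T. *)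
Definition covd (G : 'I_n -> mfield) a (T : mfield) : mfield := fun x =>
  mpd a T x - G a x *m T x - T x *m (G a x)^T.

(** The covariant derivative of a field of endomorphisms, with the covariant
index on rows; it is the one that makes [covdM] a Leibniz rule. *)
Definition endd (G : 'I_n -> mfield) a (C : mfield) : mfield := fun x =>
  mpd a C x - G a x *m C x + C x *m G a x.

(** R_{ab}^c_d is the entry (d, c) of this matrix. *)
Definition curv (G : 'I_n -> mfield) a b : mfield := fun x =>
  mpd a (G b) x - mpd b (G a) x - G a x *m G b x + G b x *m G a x.

(** The right-hand side of the Koszul formula, for K a = nabla_a h or d_a g. *)
Definition koszul (K : 'I_n -> 'M[R]_n) a : 'M[R]_n :=
  \matrix_(b, c) (2^-1 * (K a b c + K b a c - K c a b)).

(** The algebra behind the uniqueness of the Levi-Civita connection. *)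
Lemma koszul_unique (K W : 'I_n -> 'M[R]_n) a :
  (forall a, W a + (W a)^T = K a) -> (forall a b c, W a b c = W b a c) ->
  W a = koszul K a.
Proof.
move=> WK sW; apply/matrixP => b c; rewrite mxE -!WK !mxE.
rewrite (sW b a c) (sW b c a) (sW a c b); lra.
Qed.

Lemma koszul_addT (K : 'I_n -> 'M[R]_n) a : (forall a, (K a)^T = K a) ->
  koszul K a + (koszul K a)^T = K a.
Proof.
move=> sK; have s d b c : K d b c = K d c b by rewrite -{1}(sK d) mxE.
apply/matrixP => b c; rewrite !mxE (s a c b); lra.
Qed.

Lemma koszul_sym (K : 'I_n -> 'M[R]_n) a b c : (forall a, (K a)^T = K a) ->
  koszul K a b c = koszul K b a c.
Proof.
move=> sK; have s d i j : K d i j = K d j i by rewrite -{1}(sK d) mxE.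
rewrite !mxE (s c b a); ring.
Qed.

Lemma koszulZ (e : R) (K : 'I_n -> 'M[R]_n) a :
  koszul (fun a => e *: K a) a = e *: koszul K a.
Proof. by apply/matrixP => b c; rewrite !mxE; ring. Qed.

Lemma msmooth_koszul (K : 'I_n -> mfield) a : (forall a, msmooth U (K a)) ->
  msmooth U (fun x => koszul (fun a => K a x) a).
Proof.
move=> sK b c.
have : smooth_on U (fun x => 2^-1 * (K a x b c + K b x a c + - K c x a b)).
  apply: smoothM => //; first exact: smooth_cst.
  apply: smoothD => //; last exact: (smoothN oU (sK _ _ _)).
  exact: (smoothD oU (sK _ _ _) (sK _ _ _)).
by apply: smooth_ext => // x _; rewrite mxE.
Qed.

Variable G : 'I_n -> mfield.
Hypothesis sG : forall a, msmooth U (G a).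

Lemma msmooth_covd a T : msmooth U T -> msmooth U (covd G a T).
Proof.
move=> sT; apply: (msmoothD oU); last apply: (msmoothN oU).
  apply: (msmoothD oU); first exact: msmooth_mpd.
  by apply: (msmoothN oU); exact: (msmoothM oU).
by apply: (msmoothM oU) => //; exact: (msmoothT oU).
Qed.

Lemma msmooth_curv a b : msmooth U (curv G a b).
Proof.
apply: (msmoothD oU); last exact: (msmoothM oU).
apply: (msmoothD oU); last by apply: (msmoothN oU); exact: (msmoothM oU).
apply: (msmoothD oU); first exact: msmooth_mpd.
by apply: (msmoothN oU); exact: msmooth_mpd.
Qed.

Lemma covdD a S T x : U x -> msmooth U S -> msmooth U T ->
  covd G a (fun y => S y + T y) x = covd G a S x + covd G a T x.
Proof. by move=> Ux sS sT; rewrite /covd (mpdD oU)//; mx_ring. Qed.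

Lemma covdZc a (e : R) T x : U x -> msmooth U T ->
  covd G a (fun y => e *: T y) x = e *: covd G a T x.
Proof.
move=> Ux sT; rewrite /covd (mpdZc oU)//.
by rewrite -scalemxAl -scalemxAr !scalerBr.
Qed.

Lemma covdT a T x : U x -> (forall y, U y -> (T y)^T = T y) ->
  (covd G a T x)^T = covd G a T x.
Proof.
move=> Ux tT; rewrite /covd !trmxD -(mpdT oU)// (mpd_ext oU a Ux tT).
rewrite !trmxN !trmx_mul trmxK tT//. mx_ring.
Qed.

Lemma covdM a C T x : U x -> msmooth U C -> msmooth U T ->
  covd G a (fun y => C y *m T y) x = endd G a C x *m T x + C x *m covd G a T x.
Proof. by move=> Ux sC sT; rewrite /covd /endd (mpdM oU)//; mx_ring. Qed.

Lemma ricci_identity a b T x : U x -> msmooth U T ->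
  covd G a (covd G b T) x - covd G b (covd G a T) x =
  - (curv G a b x *m T x) - T x *m (curv G a b x)^T.
Proof.
move=> Ux sT.
have E c d : mpd c (covd G d T) x = mpd c (mpd d T) x
    - (mpd c (G d) x *m T x + G d x *m mpd c T x)
    - (mpd c T x *m (G d x)^T + T x *m (mpd c (G d) x)^T).
  have sGT : msmooth U (fun y => (G d y)^T) by exact: msmoothT.
  rewrite (mpdB oU) ?(mpdB oU) ?(mpdM oU) ?(mpdT oU)//.
  - exact: msmooth_mpd.
  - exact: (msmoothM oU).
  - apply: (msmoothD oU); first exact: msmooth_mpd.
    by apply: (msmoothN oU); exact: (msmoothM oU).
  - exact: (msmoothM oU).
have D c d : covd G c (covd G d T) x = mpd c (covd G d T) x
    - G c x *m covd G d T x - covd G d T x *m (G c x)^T by [].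
rewrite !D !E (mpdC oU b a)// /covd /curv; mx_ring.
Qed.

(** The difference of two connections is a tensor C, in which curvature is
quadratic. *)
Lemma curvD (C : 'I_n -> mfield) a b x : U x -> (forall a, msmooth U (C a)) ->
  curv (fun a y => G a y + C a y) a b x =
  curv G a b x + (endd G a (C b) x - endd G b (C a) x)
  - C a x *m C b x + C b x *m C a x.
Proof. by move=> Ux sC; rewrite /curv /endd !(mpdD oU)//; mx_ring. Qed.

End connections.

(** * The Levi-Civita connection *)

(** Gamma^c_{ab} as a matrix in (b, c); locked for the same reason as [mpd]. *)
HB.lock Definition conn (R : realType) (n : nat) (g : comp2 R n) (a : 'I_n)
    (x : 'rV[R]_n) : 'M[R]_n := \matrix_(b, c) christoffel g c a b x.

Section smooth_components.
Variables (R : realType) (n : nat) (U : set 'rV[R]_n).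
Implicit Types (h : comp2 R n).

Definition smooth2 h := forall a b, smooth_on U (h a b).
Definition sym2 h := forall a b x, U x -> h a b x = h b a x.

Lemma mpd_gram h a x b c : mpd a (gram h) x b c = pd a (h b c) x.
Proof.
rewrite mpdE; congr (pd a _ x); apply/funext => y; exact: mxE.
Qed.

Lemma msmooth_gram h : smooth2 h -> msmooth U (gram h).
Proof.
move=> sh a b; rewrite (_ : (fun _ => _) = h a b)//.
by apply/funext => y; rewrite mxE.
Qed.

Lemma gramT h x : sym2 h -> U x -> (gram h x)^T = gram h x.
Proof. by move=> sh Ux; apply/matrixP => a b; rewrite !mxE sh. Qed.

End smooth_components.

Section levi_civita.
Variables (R : realType) (n : nat) (U : set 'rV[R]_n).
Hypothesis oU : open U.
Implicit Types (a b c d : 'I_n) (x : 'rV[R]_n).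
Variable g : comp2 R n.
Hypothesis sg : smooth2 U g.
Hypothesis gsym : sym2 U g.
Hypothesis gunit : forall x, U x -> gram g x \in unitmx.

Local Notation G := (conn g).
Local Notation gm := (gram g).

Let sgm : msmooth U gm := msmooth_gram sg.

Lemma mpd_gramT a x : U x -> (mpd a gm x)^T = mpd a gm x.
Proof.
move=> Ux; rewrite -(mpdT oU)//; apply: (mpd_ext oU) => // y Uy.
exact: gramT gsym Uy.
Qed.

Lemma conn_koszul a x : U x ->
  G a x = koszul (fun b => mpd b gm x) a *m invmx (gm x).
Proof.
move=> Ux; have gV : (invmx (gm x))^T = invmx (gm x).
  by rewrite trmx_inv (gramT gsym Ux).
rewrite -{1}gV; apply/matrixP => b c; rewrite conn.unlock [LHS]mxE [RHS]mxE.
rewrite /christoffel mulr_sumr; apply: eq_bigr => d _.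
rewrite /ginv [in RHS]mxE [in RHS]mxE !mpd_gram; ring.
Qed.

Lemma conn_gram a x : U x -> G a x *m gm x = koszul (fun b => mpd b gm x) a.
Proof. by move=> Ux; rewrite conn_koszul// mulmxKV// gunit. Qed.

Lemma msmooth_conn a : msmooth U (G a).
Proof.
apply: (@msmooth_ext _ _ _ oU _ _
  (fun x => koszul (fun b => mpd b gm x) a *m invmx (gm x))).
  by move=> x Ux; rewrite conn_koszul.
apply: (msmoothM oU); last exact: (msmooth_inv oU).
by apply: (msmooth_koszul oU) => b; exact: msmooth_mpd.
Qed.

Lemma conn_sym a b c x : U x -> G a x b c = G b x a c.
Proof.
move=> Ux; rewrite !conn_koszul// mxE [RHS]mxE; apply: eq_bigr => d _.
by rewrite (@koszul_sym _ _ _ a)// => e; exact: mpd_gramT.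
Qed.

Lemma covd_gram a x : U x -> covd G a gm x = 0.
Proof.
move=> Ux; have := @koszul_addT _ _ (fun b => mpd b gm x) a (fun b =>
    mpd_gramT b Ux).
rewrite -conn_gram// trmx_mul (gramT gsym Ux) /covd => <-.
by rewrite addrAC addrK subrr.
Qed.

Lemma covd_ext T T' a x : U x -> (forall y, U y -> T y = T' y) ->
  covd G a T x = covd G a T' x.
Proof. by move=> Ux TT; rewrite /covd (mpd_ext oU a Ux TT) TT. Qed.

Lemma christoffelE c a b x : christoffel g c a b x = G a x b c.
Proof. by rewrite conn.unlock mxE. Qed.

(** The coordinate field d/dx^d has covariant derivative Gamma^c_{ad}, and the
terms with Gamma^e_{ab} cancel by symmetry. *)
Lemma riemannE a b c d x : U x -> riemann g a b c d x = curv G a b x d c.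
Proof.
move=> Ux; have nv : nabla_vect g (@coord_vect R n d) = fun b c =>
    christoffel g c b d.
  apply/funext => b'; apply/funext => c'; apply/funext => y.
  rewrite /nabla_vect /coord_vect pd_cst add0r (bigD1 d)//= eqxx mulr1.
  by rewrite big1 ?addr0// => e /negPf ->; rewrite mulr0.
have pE a' b' : pd a' (christoffel g c b' d) x = mpd a' (G b') x d c.
  rewrite mpdE (_ : (fun y => _) = christoffel g c b' d)//.
  by apply/funext => y; rewrite christoffelE.
rewrite /riemann nv /nabla_mixed !pE /curv !mxE.
have -> : \sum_e christoffel g e a b x * christoffel g c e d x =
          \sum_e christoffel g e b a x * christoffel g c e d x.
  by apply: eq_bigr => e _; rewrite !christoffelE (conn_sym a b)// .
have E a' b' : \sum_e christoffel g c a' e x * christoffel g e b' d x =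
  \sum_e G b' x d e * G a' x e c.
  by apply: eq_bigr => e _; rewrite !christoffelE mulrC.
rewrite !E; ring.
Qed.

Lemma ricciE b d x : U x -> ricci g b d x = \sum_a curv G a b x d a.
Proof. by move=> Ux; apply: eq_bigr => a _; rewrite riemannE. Qed.

(** The Ricci identity applied to g, whose covariant derivative vanishes: the
lowered curvature is skew in its last two indices. *)
Lemma curv_skew a b x : U x -> curv G a b x *m gm x =
    - (gm x *m (curv G a b x)^T).
Proof.
move=> Ux; have cd0 c d : covd G c (covd G d gm) x = 0.
  rewrite (covd_ext (T' := fun=> 0))//; last by move=> y Uy; rewrite covd_gram.
  by rewrite /covd mpd_cst mulmx0 mul0mx !subr0.
have := ricci_identity oU msmooth_conn a b Ux sgm.
rewrite !cd0 subrr => /esym/eqP; rewrite addrC -opprD oppr_eq0 addr_eq0.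
by move=> /eqP ->; rewrite opprK.
Qed.

Lemma curvC a b x : curv G a b x = - curv G b a x.
Proof. rewrite /curv; mx_ring. Qed.

Lemma nabla_cov2E (h : comp2 R n) a b c x :
  nabla_cov2 g h a b c x = covd G a (gram h) x b c.
Proof.
rewrite /nabla_cov2 /covd !mxE mpd_gram; congr (_ - _ - _).
  by apply: eq_bigr => e _; rewrite christoffelE mxE.
by apply: eq_bigr => e _; rewrite christoffelE !mxE mulrC.
Qed.

Lemma nabla_cov3E (h : comp2 R n) a b c d x :
  nabla_cov3 g (nabla_cov2 g h) a b c d x =
  covd G a (covd G b (gram h)) x c d - \sum_e G a x b e * covd G e (gram h) x c
      d.
Proof.
have E b' c' d' : nabla_cov2 g h b' c' d' = fun y => covd G b' (gram h) y c' d'.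
  by apply/funext => y; rewrite nabla_cov2E.
rewrite /nabla_cov3 E -mpdE.
have -> : \sum_e christoffel g e a b x * nabla_cov2 g h e c d x =
    \sum_e G a x b e * covd G e (gram h) x c d.
  by apply: eq_bigr => e _; rewrite christoffelE E.
have -> : \sum_e christoffel g e a c x * nabla_cov2 g h b e d x =
    (G a x *m covd G b (gram h) x) c d.
  by rewrite mxE; apply: eq_bigr => e _; rewrite christoffelE E.
have -> : \sum_e christoffel g e a d x * nabla_cov2 g h b c e x =
    (covd G b (gram h) x *m (G a x)^T) c d.
  by rewrite mxE; apply: eq_bigr => e _; rewrite christoffelE E mulrC;
      congr (_ * _); rewrite [RHS]mxE.
rewrite [covd G a (covd G b (gram h)) x]/covd -/(covd G b (gram h) x).
have -> A B C : (A - B - C : 'M[R]_n) c d = A c d - B c d - C c d.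
  by rewrite !mxE.
ring.
Qed.

End levi_civita.

(** * The linearised Ricci tensor and the trace of the Calabi operator *)

Section linearised_ricci.
Variables (R : realType) (n : nat).
Implicit Types (g h : comp2 R n) (a b c d : 'I_n) (x : 'rV[R]_n).

(** First variation of the connection when g varies in the direction h, with its
upper index lowered: the entry (c, d) of [dconn_low g h b] is
(nabla_b h_cd + nabla_c h_bd - nabla_d h_bc) / 2, where d is the lowered index. *)
Definition dconn_low g h b x : 'M[R]_n :=
  koszul (fun a => covd (conn g) a (gram h) x) b.

(** First variation of the curvature, with its upper index lowered.  The terms of
nabla_a S_b - nabla_b S_a in which the connection acts on the index of S cancel,
so that [covd] suffices. *)
Definition dcurv_low g h a b x : 'M[R]_n :=
  covd (conn g) a (dconn_low g h b) x - covd (conn g) b (dconn_low g h a) x.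

Definition dricci g h b d x : R :=
  \sum_a (dcurv_low g h a b x *m invmx (gram g x)) d a.

Lemma sum_half (A B C D : 'I_n -> R) :
  \sum_e A e * (2^-1 * (B e + C e - D e)) =
  2^-1 * (\sum_e A e * B e + \sum_e A e * C e - \sum_e A e * D e).
Proof.
rewrite -big_split /= -sumrB mulr_sumr; apply: eq_bigr => e _; ring.
Qed.

Lemma half_diff (t1 t2 t3 t4 t5 t6 s : R) :
  2 * (2^-1 * (t1 + t2 - t3) + s - (2^-1 * (t4 + t5 - t6) + s)) =
  t1 + t2 - t3 - (t4 + t5 - t6).
Proof. lra. Qed.

Variable U : set 'rV[R]_n.
Hypothesis oU : open U.
Variable g : comp2 R n.
Hypothesis sg : smooth2 U g.
Hypothesis gsym : sym2 U g.
Hypothesis gunit : forall x, U x -> gram g x \in unitmx.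

Local Notation G := (conn g).
Local Notation gm := (gram g).

Let sG a : msmooth U (G a) := msmooth_conn oU sg gsym gunit a.

Section fixed_h.
Variable h : comp2 R n.
Hypothesis sh : smooth2 U h.
Hypothesis hsym : sym2 U h.

Local Notation K b := (covd G b (gram h)).
Local Notation T a b c d x := (nabla_cov3 g (nabla_cov2 g h) a b c d x).

Lemma msmooth_dconn_low b : msmooth U (dconn_low g h b).
Proof.
apply: (msmooth_koszul oU) => a.
exact: (msmooth_covd oU sG a (msmooth_gram sh)).
Qed.

Lemma mpd_dconn_low a b x d c : U x -> mpd a (dconn_low g h b) x d c =
  2^-1 * (mpd a (K b) x d c + mpd a (K d) x b c - mpd a (K c) x b d).
Proof.
move=> Ux; have sK e i j : smooth_on U (fun y => K e y i j).
  exact: (msmooth_covd oU sG e (msmooth_gram sh)).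
rewrite !mpdE; have dK e i j : derivable (fun y => K e y i j) x 'e_a.
  exact: smooth_derivable (sK e i j) Ux.
have dN e i j : derivable (fun y => - K e y i j) x 'e_a.
  exact: smooth_derivable (smoothN oU (sK e i j)) Ux.
rewrite (_ : (fun y => _) = fun y => 2^-1 * (K b y d c + K d y b c + - K c y b
    d)).
  2: by apply/funext => y; rewrite mxE.
rewrite pdM; [|exact: derivable_cst|]; last first.
  by apply: derivableD => //; exact: derivableD.
rewrite pd_cst mul0r add0r pdD//; last exact: derivableD.
by rewrite pdD// pdN.
Qed.

(** [covd] does not differentiate the index b of S_b covariantly; the last sum is
the correction. *)
Lemma covd_dconn_low a b x d c : U x -> covd G a (dconn_low g h b) x d c =
  2^-1 * (T a b d c x + T a d b c x - T a c b d x)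
  + \sum_e G a x b e * dconn_low g h e x d c.
Proof.
move=> Ux; rewrite !nabla_cov3E /covd -!/(covd _ _ _).
have mE (A B C : 'M[R]_n) i j : (A - B - C) i j = A i j - B i j - C i j.
  by rewrite !mxE.
rewrite !mE mpd_dconn_low//.
have L : \sum_e G a x b e * dconn_low g h e x d c = 2^-1 *
    (\sum_e G a x b e * K e x d c + \sum_e G a x b e * K d x e c
     - \sum_e G a x b e * K c x e d).
  by rewrite -sum_half; apply: eq_bigr => e _; rewrite mxE.
have L1 : (G a x *m dconn_low g h b x) d c = 2^-1 *
    (\sum_e G a x d e * K b x e c + \sum_e G a x d e * K e x b c
     - \sum_e G a x d e * K c x b e).
  by rewrite mxE -sum_half; apply: eq_bigr => e _;
      rewrite [dconn_low _ _ _ _ _ _]mxE.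
have L2 : (dconn_low g h b x *m (G a x)^T) d c = 2^-1 *
    (\sum_e G a x c e * K b x d e + \sum_e G a x c e * K d x b e
     - \sum_e G a x c e * K e x b d).
  rewrite mxE -sum_half; apply: eq_bigr => e _.
  by rewrite [dconn_low _ _ _ _ _ _]mxE [(G a x)^T _ _]mxE mulrC.
have ML e i j : (G a x *m K e x) i j = \sum_f G a x i f * K e x f j by rewrite
    mxE.
have MR e i j : (K e x *m (G a x)^T) i j = \sum_f G a x j f * K e x i f.
  by rewrite mxE; apply: eq_bigr => f _; rewrite [(G a x)^T _ _]mxE mulrC.
rewrite L L1 L2 !ML !MR; ring.
Qed.

Lemma dcurv_lowE a b d c x : U x -> 2 * dcurv_low g h a b x d c =
  T a b d c x + T a d b c x - T a c b d x
  - (T b a d c x + T b d a c x - T b c a d x).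
Proof.
move=> Ux; have -> : dcurv_low g h a b x d c =
    covd G a (dconn_low g h b) x d c - covd G b (dconn_low g h a) x d c.
  by rewrite [LHS]mxE; congr (_ + _); rewrite mxE.
rewrite !covd_dconn_low//.
under [\sum_e G b x a e * _]eq_bigr do rewrite (conn_sym oU gsym b a)//.
exact: half_diff.
Qed.

Local Notation I x := (invmx (gm x)).

(** R_{ab}^e_c h_ed as a matrix in (c, d). *)
Definition curvH a b x : 'M[R]_n := curv G a b x *m gram h x.

Lemma nabla_cov3C a b c d x : U x ->
  T a b c d x = T b a c d x - curvH a b x c d - curvH a b x d c.
Proof.
move=> Ux; have := ricci_identity oU sG a b Ux (msmooth_gram sh).
move=> /matrixP/(_ c d); rewrite !nabla_cov3E.
under [\sum_e G b x a e * _]eq_bigr do rewrite (conn_sym oU gsym b a)//.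
have -> : gram h x *m (curv G a b x)^T = (curvH a b x)^T.
  by rewrite trmx_mul (gramT hsym).
rewrite -/(curvH a b x).
have mE (A B : 'M[R]_n) i j : (A - B) i j = A i j - B i j by rewrite !mxE.
have mN (A : 'M[R]_n) i j : (- A) i j = - A i j by rewrite !mxE.
have mT (A : 'M[R]_n) i j : A^T i j = A j i by rewrite !mxE.
rewrite !mE mN mT.
move: ((covd G a (K b) x) c d) ((covd G b (K a) x) c d) => u v.
move: (curvH a b x c d) (curvH a b x d c) (\sum_e _) => q q' s.
by move=> /(canRL (subrK _)) ->; ring.
Qed.

Lemma riemann_skewE a b c d x : U x ->
  riemann_skew g h a b c d x = 2^-1 * (curvH a b x c d - curvH a b x d c).
Proof.
move=> Ux; rewrite /riemann_skew; congr (_ * (_ - _)).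
  rewrite [RHS]mxE; apply: eq_bigr => e _.
  by rewrite (riemannE oU gsym)// [gram h x _ _]mxE (hsym d e Ux).
rewrite [RHS]mxE; apply: eq_bigr => e _.
by rewrite (riemannE oU gsym)// [gram h x _ _]mxE (hsym c e Ux).
Qed.

Lemma curvHC a b x c d : curvH a b x c d = - curvH b a x c d.
Proof. by rewrite /curvH curvC mulNmx mxE. Qed.

(** The scalar identity behind [calabi_trace_dricci]: t stands for second
covariant derivatives of h and q for curvature terms, and the local
definitions are Ricci identities. *)
Lemma calabi_arith
  (tabdc tadbc tacbd tbdac tbcad qabcd qabdc qcabd qcadb qbcad qbcda qadbc
   qadcb qdbac qdbca qcdab qcdba : R) :
  let tcabd := tacbd - qcabd - qcadb in
  let tcbad := tbcad + qbcad + qbcda in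
  let tdabc := tadbc + qadbc + qadcb in
  let tdbac := tbdac - qdbac - qdbca in
  let tbadc := tabdc + qabdc + qabcd in
  2^-1 * (tacbd + tcabd) - 2^-1 * (tbcad + tcbad) - 2^-1 * (tadbc + tdabc)
  + 2^-1 * (tbdac + tdbac) - 2^-1 * (qabcd - qabdc) - 2^-1 * (qcdab - qcdba)
  = - (tabdc + tadbc - tacbd - (tbadc + tbdac - tbcad))
   - 2^-1 * (qcabd + qcadb) - 2^-1 * (qbcad + qbcda) - 2^-1 * (qadbc + qadcb)
   - 2^-1 * (qdbac + qdbca) - (qabdc + qabcd)
   - 2^-1 * (qabcd - qabdc) - 2^-1 * (qcdab - qcdba).
Proof. cbv zeta; lra. Qed.

(** Commuting derivatives brings the Calabi operator to minus twice the variation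
of the curvature, up to terms linear in the curvature. *)
Lemma calabiE a b c d x : U x ->
  calabi g h a b c d x = - (2 * dcurv_low g h a b x d c)
   - 2^-1 * (curvH c a x b d + curvH c a x d b)
   - 2^-1 * (curvH b c x a d + curvH b c x d a)
   - 2^-1 * (curvH a d x b c + curvH a d x c b)
   - 2^-1 * (curvH d b x a c + curvH d b x c a)
   - (curvH a b x d c + curvH a b x c d)
   - 2^-1 * (curvH a b x c d - curvH a b x d c)
   - 2^-1 * (curvH c d x a b - curvH c d x b a).
Proof.
move=> Ux; rewrite dcurv_lowE// /calabi /hess_sym !riemann_skewE//.
rewrite (nabla_cov3C c a)// (nabla_cov3C c b)// (nabla_cov3C d a)//
    (nabla_cov3C d b)// (nabla_cov3C b a)//.
rewrite (curvHC c b x a d) (curvHC c b x d a) (curvHC d a x b c) (curvHC d a x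
    c b).
rewrite (curvHC b a x c d) (curvHC b a x d c) !opprK.
exact: calabi_arith.
Qed.

Lemma curv_inv a b x : U x -> I x *m curv G a b x = - ((curv G a b x)^T *m I x).
Proof.
move=> Ux; have := curv_skew oU sg gsym gunit a b Ux.
move=> /(congr1 (fun A => I x *m A *m I x)).
by rewrite mulmxN mulNmx !mulmxA mulVmx ?gunit// mul1mx mulmxK ?gunit.
Qed.

(** This is g^{cd} h_ed R_{ab}^e_c: the lowered curvature, skew in its last two
indices, contracted with a symmetric tensor. *)
Lemma trace_skew a b x : U x ->
  \sum_c \sum_d I x c d * curvH a b x c d = 0.
Proof.
move=> Ux; have IT : (I x)^T = I x by rewrite trmx_inv (gramT gsym Ux).
have E : \sum_c \sum_d I x c d * curvH a b x c d = \tr (I x *m curvH a b x).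
  rewrite -{2}IT; rewrite /mxtrace exchange_big; apply: eq_bigr => d _ /=.
  by rewrite mxE; apply: eq_bigr => c _; rewrite [_^T _ _]mxE.
rewrite E; have : \tr (I x *m curvH a b x) = - \tr (I x *m curvH a b x).
  have e1 : I x *m curvH a b x = - ((curv G a b x)^T *m I x *m gram h x).
    by rewrite mulmxA curv_inv// mulNmx.
  transitivity (\tr (- ((curv G a b x)^T *m I x *m gram h x))).
    by rewrite -e1.
  rewrite raddfN /=; congr (- _); rewrite -[LHS]mxtrace_tr !trmx_mul trmxK IT.
  by rewrite (gramT hsym Ux) mxtrace_mulC -mulmxA.
by move/eqP; rewrite -subr_eq0 opprK -mulr2n mulrn_eq0 /= => /eqP.
Qed.

Section einstein_trace.
Variables (lam : R) (x : 'rV[R]_n).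
Hypothesis Ux : U x.
Hypothesis ein : forall b d, ricci g b d x = lam * g b d x.

(** By skewness the trace can be moved to the pair of indices that gives the Ricci
tensor. *)
Lemma trace_einstein b d :
  \sum_a \sum_c I x a c * curvH a b x c d = - (lam * h b d x).
Proof.
have -> : \sum_a \sum_c I x a c * curvH a b x c d =
   \sum_a (I x *m curvH a b x) a d.
  by apply: eq_bigr => a _; rewrite [RHS]mxE.
have ric : \row_e (\sum_a curv G a b x e a) = lam *: row b (gm x).
  by apply/rowP => e; rewrite !mxE -(ricciE oU gsym)// ein.
transitivity (- ((\row_e (\sum_a curv G a b x e a)) *m (I x *m gram h x)) 0 d).
  transitivity (\sum_a - \sum_e curv G a b x e a * (I x *m gram h x) e d).
    apply: eq_bigr => a _; rewrite mulmxA curv_inv// mulNmx -mulmxA [LHS]mxE.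
    by congr (- _); rewrite mxE; apply: eq_bigr => e _; rewrite [_^T _ _]mxE.
  rewrite sumrN exchange_big /=; congr (- _); rewrite [RHS]mxE.
  by apply: eq_bigr => e _; rewrite -mulr_suml; congr (_ * _); rewrite [RHS]mxE.
by rewrite ric -scalemxAl -row_mul mulmxA mulmxV ?gunit// mul1mx !mxE.
Qed.

(** After tracing [calabiE], the curvature terms vanish or cancel in pairs by
symmetry of the trace, except two which [trace_einstein] evaluates. *)
Theorem calabi_trace_dricci b d :
  calabi_trace g h b d x = - 2 * (dricci g h b d x - lam * h b d x).
Proof.
pose tr (F : 'I_n -> 'I_n -> R) := \sum_a \sum_c I x a c * F a c.
have trD F F' : tr (fun a c => F a c + F' a c) = tr F + tr F'.
  rewrite /tr -big_split; apply: eq_bigr => a _ /=; rewrite -big_split.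
  by apply: eq_bigr => c _ /=; rewrite mulrDr.
have trZ e F : tr (fun a c => e * F a c) = e * tr F.
  rewrite /tr mulr_sumr; apply: eq_bigr => a _; rewrite mulr_sumr.
  by apply: eq_bigr => c _ /=; rewrite mulrCA.
have Isym a c : I x a c = I x c a.
  by rewrite -{1}[I x]trmxK trmx_inv (gramT gsym Ux) mxE.
have trT F : tr (fun a c => F c a) = tr F.
  rewrite /tr exchange_big; apply: eq_bigr => a _; apply: eq_bigr => c _ /=.
  by rewrite Isym.
have trN (F F' : 'I_n -> 'I_n -> R) : (forall a c, F a c = - F' a c) ->
    tr F = - tr F'.
  move=> FF; rewrite -[RHS]mulN1r -trZ; apply: eq_bigr => a _.
  by apply: eq_bigr => c _; rewrite FF mulN1r.
have trE (F F' : 'I_n -> 'I_n -> R) : (forall a c, F a c = F' a c) -> tr F =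
    tr F'.
  by move=> FF; apply: eq_bigr => a _; apply: eq_bigr => c _; rewrite FF.
have tr_dcurv : tr (fun a c => dcurv_low g h a b x d c) = dricci g h b d x.
  apply: eq_bigr => a _; rewrite mxE; apply: eq_bigr => c _.
  by rewrite mulrC Isym.
pose q1 := tr (fun a c => curvH a b x c d).
pose q2 := tr (fun a c => curvH a d x c b).
pose q3 := tr (fun a c => curvH a b x d c).
pose q4 := tr (fun a c => curvH a d x b c).
have q1E : q1 = - (lam * h b d x) by exact: trace_einstein.
have q2E : q2 = - (lam * h b d x).
  by rewrite /q2 [LHS]trace_einstein (hsym d b Ux).
have t1 : tr (fun a c => curvH c a x b d) = 0.
  have : tr (fun a c => curvH c a x b d) = - tr (fun a c => curvH c a x b d).
    by rewrite -{1}trT; apply: trN => a c; rewrite curvHC.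
  by move/eqP; rewrite -subr_eq0 opprK -mulr2n mulrn_eq0 /= => /eqP.
have t2 : tr (fun a c => curvH c a x d b) = 0.
  have : tr (fun a c => curvH c a x d b) = - tr (fun a c => curvH c a x d b).
    by rewrite -{1}trT; apply: trN => a c; rewrite curvHC.
  by move/eqP; rewrite -subr_eq0 opprK -mulr2n mulrn_eq0 /= => /eqP.
have t3 : tr (fun a c => curvH b c x a d) = - q1.
  by rewrite -trT; apply: trN => a c; rewrite curvHC.
have t4 : tr (fun a c => curvH b c x d a) = - q3.
  by rewrite -trT; apply: trN => a c; rewrite curvHC.
have t5 : tr (fun a c => curvH d b x a c) = 0 by exact: trace_skew.
have t6 : tr (fun a c => curvH d b x c a) = 0.
  by rewrite trT t5.
have t7 : tr (fun a c => curvH c d x a b) = q2 by rewrite /q2 -trT.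
have t8 : tr (fun a c => curvH c d x b a) = q4 by rewrite /q4 -trT.
have -> : calabi_trace g h b d x = tr (fun a c => calabi g h a b c d x) by [].
have -> : tr (fun a c => calabi g h a b c d x) = tr (fun a c =>
  (-2) * dcurv_low g h a b x d c +
  ((- 2^-1) * curvH c a x b d + ((- 2^-1) * curvH c a x d b +
  ((- 2^-1) * curvH b c x a d + ((- 2^-1) * curvH b c x d a +
  ((- 2^-1) * curvH a d x b c + ((- 2^-1) * curvH a d x c b +
  ((- 2^-1) * curvH d b x a c + ((- 2^-1) * curvH d b x c a +
  ((- 2^-1) * curvH a b x d c + ((- (1 + 2^-1)) * curvH a b x c d +
  ((- 2^-1) * curvH c d x a b + 2^-1 * curvH c d x b a)))))))))))).
  apply: trE => a c; rewrite calabiE//.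
  move: (dcurv_low _ _ _ _ _ _ _) => z.
  move: (curvH c a x b d) (curvH c a x d b) (curvH b c x a d) (curvH b c x d a).
  move: (curvH a d x b c) (curvH a d x c b) (curvH d b x a c) (curvH d b x c a).
  move: (curvH a b x d c) (curvH a b x c d) (curvH c d x a b) (curvH c d x b a).
  by move=> *; lra.
rewrite !trD !trZ tr_dcurv t1 t2 t3 t4 t5 t6 t7 t8 -/q1 -/q2 -/q3 -/q4 q1E q2E.
clearbody q3 q4; move: (dricci g h b d x) (lam * h b d x) => u v; lra.
Qed.

End einstein_trace.
End fixed_h.
End linearised_ricci.

(** * Perturbing the metric *)

Section perturbation.
Variables (R : realType) (n : nat).
Implicit Types (a b c d : 'I_n) (x : 'rV[R]_n).
Variables (g h : comp2 R n).

Local Notation gt := (perturb g h).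

Lemma gram_perturb eps x : gram (gt eps) x = gram g x + eps *: gram h x.
Proof. by apply/matrixP => a b; rewrite !mxE. Qed.

Lemma koszul_ext (K K' : 'I_n -> 'M[R]_n) a : (forall a, K a = K' a) ->
    koszul K a = koszul K' a.
Proof. by move=> KK; apply/matrixP => b c; rewrite !mxE !KK. Qed.

Section exact_expansion.
Variable U : set 'rV[R]_n.
Hypothesis oU : open U.
Hypothesis sg : smooth2 U g.
Hypothesis gsym : sym2 U g.
Hypothesis gunit : forall x, U x -> gram g x \in unitmx.
Hypothesis sh : smooth2 U h.
Hypothesis hsym : sym2 U h.
Variable eps : R.
Hypothesis gtunit : forall x, U x -> gram (gt eps) x \in unitmx.

Let sgt : smooth2 U (gt eps).
Proof.
move=> a b; apply: (smoothD oU) => //; apply: smoothM => //; exact: smooth_cst.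
Qed.

Let gtsym : sym2 U (gt eps).
Proof. by move=> a b x Ux; rewrite /perturb gsym// hsym. Qed.

Let sG a : msmooth U (conn g a) := msmooth_conn oU sg gsym gunit a.
Let sGt a : msmooth U (conn (gt eps) a) := msmooth_conn oU sgt gtsym gtunit a.

Definition conn_diff a x : 'M[R]_n := conn (gt eps) a x - conn g a x.

Lemma msmooth_conn_diff a : msmooth U (conn_diff a).
Proof. by apply: (msmoothD oU) => //; exact: msmoothN. Qed.

Lemma covd_gram_perturb a x : U x ->
  covd (conn g) a (gram (gt eps)) x = eps *: covd (conn g) a (gram h) x.
Proof.
move=> Ux; have sgm := msmooth_gram sg; have shm := msmooth_gram sh.
rewrite -(covdZc oU)// -[RHS]add0r -(covd_gram oU gsym gunit a Ux).
rewrite -(covdD oU)//; last by apply: (msmoothZ oU) => //; exact: smooth_cst.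
by apply: (covd_ext oU) => // y _; exact: gram_perturb.
Qed.

(** nabla (g + eps h) = eps nabla h, so the change of the connection solves the
Koszul equations for eps nabla h. *)
Lemma conn_diff_gram a x : U x ->
  conn_diff a x *m gram (gt eps) x = eps *: dconn_low g h a x.
Proof.
move=> Ux.
rewrite /dconn_low -koszulZ -(koszul_ext (K := fun b =>
    covd (conn g) b (gram (gt eps)) x)).
  2: by move=> b; rewrite covd_gram_perturb.
apply: (@koszul_unique _ _ _ (fun b => conn_diff b x *m gram (gt eps) x)) =>
    [b|b c d].
  have := covd_gram oU gtsym gtunit b Ux; rewrite /covd => /eqP.
  rewrite subr_eq0 subr_eq => /eqP ->.
  rewrite trmx_mul (gramT gtsym Ux) /conn_diff; mx_ring.
rewrite mxE [RHS]mxE; apply: eq_bigr => e _; congr (_ * _).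
have mE (A B : 'M[R]_n) i j : (A - B) i j = A i j - B i j by rewrite !mxE.
by rewrite !mE (conn_sym oU gtsym b c)// (conn_sym oU gsym b c).
Qed.

Local Notation I x := (invmx (gram g x)).
Local Notation J x := (invmx (gram (gt eps) x)).
Local Notation K a x := (covd (conn g) a (gram h) x).
Local Notation S a x := (dconn_low g h a x).

(** The coefficient of eps^2 in the curvature of g + eps h; I and J are the inverses
of the metrics g and g + eps h, K1 and K2 are covariant derivatives of H. *)
Definition quad_rem (H K1 K2 S1 S2 Z I J : 'M[R]_n) : 'M[R]_n :=
  - (Z *m I *m H *m J) - S2 *m J *m K1 *m J + S1 *m J *m K2 *m J
  - S1 *m J *m S2 *m J + S2 *m J *m S1 *m J.

Lemma conn_diffE a x : U x -> conn_diff a x = eps *: (S a x *m J x).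
Proof.
move=> Ux; rewrite scalemxAl -conn_diff_gram// mulmxK//; exact: gtunit.
Qed.

Lemma endd_conn_diff a b x : U x ->
  endd (conn g) a (conn_diff b) x =
  eps *: (covd (conn g) a (dconn_low g h b) x *m J x)
  - eps ^+ 2 *: (S b x *m J x *m K a x *m J x).
Proof.
move=> Ux; have sgm := msmooth_gram sgt.
have := covdM oU (conn g) a Ux (msmooth_conn_diff b) sgm.
rewrite (covd_ext (T' := fun y => eps *: dconn_low g h b y) oU _ a Ux);
    last first.
  by move=> y Uy; rewrite conn_diff_gram.
rewrite (covdZc oU)//; last exact: (msmooth_dconn_low oU sg gsym gunit sh).
rewrite covd_gram_perturb// conn_diffE// => /eqP.
rewrite -subr_eq => /eqP/(congr1 (fun A => A *m J x)).
rewrite mulmxK ?gtunit// => <-.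
rewrite mulmxBl; congr (_ - _); first by rewrite scalemxAl.
by rewrite -scalemxAr -!scalemxAl scalerA expr2.
Qed.

Lemma inv_perturb x : U x -> J x = I x - eps *: (I x *m gram h x *m J x).
Proof.
move=> Ux; have e : I x *m gram (gt eps) x *m J x = I x.
  by rewrite -mulmxA mulmxV ?mulmx1// gtunit.
rewrite -{1}e gram_perturb mulmxDr mulVmx ?gunit// mulmxDl mul1mx.
by rewrite -scalemxAr -scalemxAl addrK.
Qed.

Lemma curv_perturb a b x : U x ->
  curv (conn (gt eps)) a b x = curv (conn g) a b x
   + eps *: (dcurv_low g h a b x *m I x)
   + eps ^+ 2 *: quad_rem (gram h x) (K a x) (K b x) (S a x) (S b x)
                   (dcurv_low g h a b x) (I x) (J x).
Proof.
move=> Ux.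
have -> : curv (conn (gt eps)) a b x =
   curv (fun c y => conn g c y + conn_diff c y) a b x.
  congr (curv _ a b x); apply/funext => c; apply/funext => y.
  by rewrite /conn_diff addrC subrK.
rewrite (curvD oU)//; last exact: msmooth_conn_diff.
rewrite !endd_conn_diff// !conn_diffE// /dcurv_low.
set Za := covd _ a _ _; set Zb := covd _ b _ _.
have -> : Za *m J x = Za *m I x - eps *: (Za *m I x *m gram h x *m J x).
  by rewrite {1}inv_perturb// mulmxBr -scalemxAr !mulmxA.
have -> : Zb *m J x = Zb *m I x - eps *: (Zb *m I x *m gram h x *m J x).
  by rewrite {1}inv_perturb// mulmxBr -scalemxAr !mulmxA.
rewrite /quad_rem.
move: (curv _ _ _ _) => X0.
move: Za Zb (S a x) (S b x) (I x) (J x) (gram h x) (K a x) (K b x) => *.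
mx_ring.
Qed.

(** An exact identity, in which eps also occurs in the inverse metric inside the
last term. *)
Lemma ricci_perturb b d x : U x ->
  ricci (gt eps) b d x = ricci g b d x + eps * dricci g h b d x
  + eps ^+ 2 * \sum_a (quad_rem (gram h x) (K a x) (K b x) (S a x) (S b x)
                   (dcurv_low g h a b x) (I x) (J x)) d a.
Proof.
move=> Ux; rewrite (ricciE oU gtsym)// (ricciE oU gsym)// /dricci.
rewrite !mulr_sumr -!big_split; apply: eq_bigr => a _ /=.
have mE (A B C : 'M[R]_n) (u v : R) i j :
    (A + u *: B + v *: C) i j = A i j + u * B i j + v * C i j by rewrite !mxE.
by rewrite curv_perturb// mE.
Qed.

End exact_expansion.

Section uniform_bound.
Variable U : set 'rV[R]_n.
Hypothesis oU : open U.
Hypothesis sg : smooth2 U g.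
Hypothesis gsym : sym2 U g.
Hypothesis gunit : forall x, U x -> gram g x \in unitmx.
Hypothesis sh : smooth2 U h.
Hypothesis hsym : sym2 U h.

Lemma open_perturb_unit eps :
  open (U `&` [set x | gram (gt eps) x \in unitmx]).
Proof.
have sgt : msmooth U (gram (gt eps)).
  apply: msmooth_gram => a b; apply: (smoothD oU) => //.
  by apply: smoothM => //; exact: smooth_cst.
rewrite openE => x [Ux ux]; rewrite /interior.
have cx := smooth_continuous (smooth_det oU sgt) Ux.
have nU : nbhs x U by exact: open_nbhs_nbhs.
move: ux; rewrite /= unitmxE unitfE => dx.
have : nbhs (\det (gram (gt eps) x)) [set t : R | t != 0].
  by apply: open_nbhs_nbhs; split => //; exact: open_neq.
move=> /cx cx0; apply: filterS (filterI nU cx0) => y [Uy /= dy].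
by split => //=; rewrite unitmxE unitfE.
Qed.

End uniform_bound.
End perturbation.

Section entrywise_limits.
Variables (R : realType) (T : Type) (F : set_system T).
Hypothesis FF : ProperFilter F.

(** Entrywise convergence, so that limits of products, determinants and inverses
reduce to limits of scalars along an arbitrary filter. *)
Definition mcvg p q (M : T -> 'M[R]_(p, q)) (L : 'M[R]_(p, q)) :=
  forall i j, M t i j @[t --> F] --> L i j.

Lemma mcvgD p q (M N : T -> 'M[R]_(p, q)) L L' : mcvg M L -> mcvg N L' ->
  mcvg (fun t => M t + N t) (L + L').
Proof.
move=> ML NL i j; rewrite mxE; under eq_fun do rewrite mxE.
by apply: cvgD; [exact: ML|exact: NL].
Qed.

Lemma mcvgN p q (M : T -> 'M[R]_(p, q)) L : mcvg M L ->
  mcvg (fun t => - M t) (- L).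
Proof.
move=> ML i j; rewrite mxE; under eq_fun do rewrite mxE.
by apply: cvgN; exact: ML.
Qed.

Lemma mcvgM p q r (M : T -> 'M[R]_(p, q)) (N : T -> 'M[R]_(q, r)) L L' :
  mcvg M L -> mcvg N L' -> mcvg (fun t => M t *m N t) (L *m L').
Proof.
move=> ML NL i j; rewrite mxE; under eq_fun do rewrite mxE.
apply: cvg_big => [|k _]; first exact: add_continuous.
by apply: cvgM; [exact: ML|exact: NL].
Qed.

Lemma mcvg_det p (M : T -> 'M[R]_p) L : mcvg M L ->
  \det (M t) @[t --> F] --> \det L.
Proof.
move=> ML; apply: cvg_big => [|s _]; first exact: add_continuous.
apply: cvgM; first exact: cvg_cst.
by apply: cvg_big => [|k _]; [exact: mul_continuous|exact: ML].
Qed.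

Lemma mcvg_inv p (M : T -> 'M[R]_p) L : mcvg M L -> L \in unitmx ->
  (\forall t \near F, M t \in unitmx) /\ mcvg (fun t => invmx (M t)) (invmx L).
Proof.
move=> ML uL; have dM := mcvg_det ML.
have d0 : \det L != 0 by rewrite -unitfE -unitmxE.
have nu : \forall t \near F, M t \in unitmx.
  have : nbhs (\det L) [set t : R | t != 0].
    by apply: open_nbhs_nbhs; split => //; exact: open_neq.
  move=> /dM nd; near=> t; rewrite unitmxE unitfE; near: t; exact: nd.
split => // i j.
have -> : invmx L i j = (\det L)^-1 * cofactor L j i.
  by rewrite /invmx uL !mxE.
have : (\det (M t))^-1 * cofactor (M t) j i @[t --> F] -->
    (\det L)^-1 * cofactor L j i.
  apply: cvgM; first exact: cvgV.
  apply: cvgM; first exact: cvg_cst.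
  apply: mcvg_det => k l; rewrite !mxE; under eq_fun do rewrite !mxE.
  exact: ML.
apply: cvg_trans; apply: near_eq_cvg; near=> t.
have -> : invmx (M t) i j = (\det (M t))^-1 * cofactor (M t) j i.
  by rewrite /invmx (_ : M t \in unitmx) ?mxE//; near: t.
by [].
Unshelve. all: by end_near. Qed.

Lemma cvg_near_bounded (f : T -> R) (l : R) : f t @[t --> F] --> l ->
  \forall t \near F, `|f t| <= `|l| + 1.
Proof.
move/cvgrPdist_le => /(_ _ ltr01); apply: filterS => t ft.
rewrite -lerBlDl (le_trans _ ft)// distrC.
exact: lerB_dist.
Qed.

End entrywise_limits.

(** * The first-order Einstein equation *)

Section first_order.
Variables (R : realType) (n : nat) (U : set 'rV[R]_n).
Implicit Types (a b c d : 'I_n) (x : 'rV[R]_n).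
Variables (g h : comp2 R n).
Local Notation gt := (perturb g h).
Hypothesis oU : open U.
Hypothesis sg : smooth2 U g.
Hypothesis gsym : sym2 U g.
Hypothesis gunit : forall x, U x -> gram g x \in unitmx.
Hypothesis sh : smooth2 U h.
Hypothesis hsym : sym2 U h.

Lemma mcvg_smooth (F : set_system ('rV[R]_n * R)) (x0 : 'rV[R]_n)
    (M : 'rV[R]_n -> 'M[R]_n) :
  Filter F -> fst @ F --> x0 -> msmooth U M -> U x0 ->
  mcvg F (fun z => M z.1) (M x0).
Proof.
move=> FF Fx0 sM Ux0 i j.
exact: (cvg_comp _ _ Fx0 (smooth_continuous (sM i j) Ux0)).
Qed.

(** The coefficient of eps^2 in [ricci_perturb] converges as (x, eps) tends to
(x0, 0), hence is bounded near that point. *)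
Lemma ricci_remainder x0 b d : U x0 -> exists C : R,
  \forall x \near x0 & eps \near (0 : R), gram (gt eps) x \in unitmx /\
    `|ricci (gt eps) b d x - ricci g b d x - eps * dricci g h b d x| <=
        C * eps ^+ 2.
Proof.
move=> Ux0; pose F := filter_prod (nbhs x0) (nbhs (0 : R)).
have FF : ProperFilter F by exact: filter_prod_proper.
have fF : Filter F by exact: filter_prod_filter.
have F1 : fst @ F --> x0 by exact: cvg_fst.
have F2 : snd @ F --> (0 : R) by exact: cvg_snd.
have sG a : msmooth U (conn g a) := msmooth_conn oU sg gsym gunit a.
have sS a := msmooth_dconn_low oU sg gsym gunit sh a.
have sK a := msmooth_covd oU sG a (msmooth_gram sh).
have sZ a : msmooth U (dcurv_low g h a b).
  apply: (msmoothD oU); first exact: msmooth_covd.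
  by apply: (msmoothN oU); exact: msmooth_covd.
have cgt : mcvg F (fun z => gram (gt z.2) z.1) (gram g x0).
  move=> i j.
  have : gram g z.1 i j + z.2 * gram h z.1 i j @[z --> F] -->
      gram g x0 i j + 0 * gram h x0 i j.
    apply: cvgD; first exact: (mcvg_smooth _ F1 (msmooth_gram sg)).
    by apply: cvgM => //; exact: (mcvg_smooth _ F1 (msmooth_gram sh)).
  rewrite mul0r addr0; congr (cvg_to _ _); congr (_ @ F); apply/funext => z.
  by rewrite gram_perturb [RHS]mxE; congr (_ + _); rewrite [RHS]mxE.
have [nu cJ] := mcvg_inv _ cgt (gunit Ux0).
have cI := mcvg_smooth fF F1 (msmooth_inv oU (msmooth_gram sg) gunit) Ux0.
have cst M (sM : msmooth U M) := mcvg_smooth fF F1 sM Ux0.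
have cH := cst _ (msmooth_gram sh).
pose Qm a (z : 'rV[R]_n * R) := quad_rem (gram h z.1)
   (covd (conn g) a (gram h) z.1) (covd (conn g) b (gram h) z.1)
   (dconn_low g h a z.1) (dconn_low g h b z.1) (dcurv_low g h a b z.1)
   (invmx (gram g z.1)) (invmx (gram (gt z.2) z.1)).
(* Only the existence of a limit of the remainder matters. *)
have cQ a : exists L, mcvg F (Qm a) L.
  eexists; rewrite /Qm /quad_rem.
  apply: mcvgD; first apply: mcvgD; first apply: mcvgD; first apply: mcvgD.
  - by apply: mcvgN; apply: (mcvgM _ _ cJ); apply: (mcvgM _ _ cH);
      apply: (mcvgM _ _ cI); exact: cst.
  - apply: mcvgN; apply: (mcvgM _ _ cJ); apply: mcvgM; last exact: cst (sK a).
    by apply: (mcvgM _ _ cJ); exact: cst.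
  - apply: (mcvgM _ _ cJ); apply: mcvgM; last exact: cst (sK b).
    by apply: (mcvgM _ _ cJ); exact: cst.
  - apply: mcvgN; apply: (mcvgM _ _ cJ); apply: mcvgM; last exact: cst (sS b).
    by apply: (mcvgM _ _ cJ); exact: cst.
  - apply: (mcvgM _ _ cJ); apply: mcvgM; last exact: cst (sS a).
    by apply: (mcvgM _ _ cJ); exact: cst.
have [L cL] := choice cQ.
have cs : \sum_a Qm a z d a @[z --> F] --> \sum_a L a d a.
  by apply: cvg_sum_ord => a; exact: cL.
have bs := cvg_near_bounded FF cs.
exists (`|\sum_a L a d a| + 1).
have nU : \forall z \near F, U z.1.
  by apply: F1; exact: open_nbhs_nbhs.
suff : \forall z \near F, gram (gt z.2) z.1 \in unitmx /\
  `|ricci (gt z.2) b d z.1 - ricci g b d z.1 - z.2 * dricci g h b d z.1|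
    <= (`|\sum_a L a d a| + 1) * z.2 ^+ 2 by exact.
near=> z.
have uz : gram (gt z.2) z.1 \in unitmx by near: z.
have Uz : U z.1 by near: z.
split => //.
have sub : U `&` [set x | gram (gt z.2) x \in unitmx] `<=` U by move=> ? [].
have sub2 f : smooth2 U f -> smooth2 (U `&` [set x | gram (gt z.2) x \in
    unitmx]) f.
  by move=> sf i j; exact: smooth_sub (sf i j).
have gsym' : sym2 (U `&` [set x | gram (gt z.2) x \in unitmx]) g.
  by move=> i j y /sub; exact: gsym.
have hsym' : sym2 (U `&` [set x | gram (gt z.2) x \in unitmx]) h.
  by move=> i j y /sub; exact: hsym.
have gunit' y : (U `&` [set x | gram (gt z.2) x \in unitmx]) y ->
    gram g y \in unitmx.
  by move=> /sub; exact: gunit.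
rewrite (ricci_perturb (open_perturb_unit (eps :=
    z.2) oU sg sh) (sub2 _ sg) gsym' gunit'
  (sub2 _ sh) hsym' (fun y Uy => Uy.2) b d (conj Uz uz)).
rewrite (_ : forall u v w : R, u + v + w - u - v = w); last by move=> *; ring.
rewrite normrM mulrC (ger0_norm (sqr_ge0 z.2)) ler_wpM2r ?sqr_ge0//.
by near: z.
Unshelve. all: by end_near. Qed.

Variable lam : R.
Hypothesis ein : forall b d x, U x -> ricci g b d x = lam * g b d x.

(** Up to O(eps^2), Ric(g + eps h) - lam (g + eps h) is eps (dricci h - lam h) by
[ricci_remainder], and a constant v with |eps v| <= C eps^2 for all small eps
vanishes. *)
Theorem einstein_first_order_dricci :
  (forall b d x, U x -> dricci g h b d x = lam * h b d x) <->
  (forall x0, U x0 -> forall b d, exists C : R,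
    \forall x \near x0 & eps \near (0 : R), gram (gt eps) x \in unitmx /\
      `|ricci (gt eps) b d x - lam * gt eps b d x| <= C * eps ^+ 2).
Proof.
split=> [lin x0 Ux0 b d|bd b d x0 Ux0].
  have [C hC] := ricci_remainder b d Ux0; exists C.
  have nU : \forall x \near x0 & eps \near (0 : R), U x.
    exists (U, setT) => /=; last by move=> z [].
    by split; [exact: open_nbhs_nbhs|exact: filterT].
  apply: filterS2 nU hC => -[x eps] /= Ux [u].
  rewrite ein// lin// => le; split => //; apply: le_trans le.
  rewrite /perturb le_eqVlt; apply/orP; left; apply/eqP; congr (`|_|).
  by rewrite mulrDr opprD addrA; congr (_ - _); rewrite mulrCA.
have [C1 h1] := bd x0 Ux0 b d.
have [C2 h2] := ricci_remainder b d Ux0.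
set v := dricci g h b d x0 - lam * h b d x0.
suff v0 : v = 0 by apply/eqP; rewrite -subr_eq0 -/v v0.
have near0 : \forall eps \near (0 : R), `|eps * v| <= (C1 + C2) * eps ^+ 2.
  have [[A B] /= [nA nB] AB] := filterI h1 h2.
  apply: filterS nB => eps Be.
  have [[_ b1] [_ b2]] := AB (x0, eps) (conj (nbhs_singleton nA) Be).
  rewrite /= in b1 b2.
  have -> : eps * v = (ricci (gt eps) b d x0 - lam * gt eps b d x0)
     - (ricci (gt eps) b d x0 - ricci g b d x0 - eps * dricci g h b d x0).
    rewrite ein// /perturb /v.
    move: (ricci _ _ _ _) (dricci _ _ _ _ _) (g b d x0) (h b d x0) => *; ring.
  by rewrite (le_trans (ler_normB _ _))// mulrDl lerD.
apply/eqP; rewrite -normr_eq0 -[_ == 0]negbK; apply/negP => vn0.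
have vp : 0 < `|v| by rewrite lt_neqAle eq_sym vn0 normr_ge0.
pose C := `|C1 + C2| + 1.
have Cp : 0 < C by rewrite ltr_wpDl.
have [e e0 he] : exists2 e : R, 0 < e & forall t, `|t| < e -> `|t * v| <=
    (C1 + C2) * t ^+ 2.
  move/nbhs_normP : near0 => [e /= e0 he]; exists e => // t te.
  by apply: he; rewrite /= sub0r normrN.
(* The estimate at this t would give `|v| <= `|v| / 2. *)
pose t := Num.min (e / 2) (`|v| / (2 * C)).
have tp : 0 < t by rewrite lt_min !divr_gt0// mulr_gt0.
have te : `|t| < e.
  rewrite gtr0_norm// (@le_lt_trans _ _ (e / 2))// ?ge_min ?lexx//; lra.
have := he t te; rewrite normrM (gtr0_norm tp) expr2 mulrCA ler_pM2l//.
apply/negP; rewrite -ltNge.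
have tv : t * C <= `|v| / 2.
  have : t <= `|v| / (2 * C) by rewrite ge_min lexx orbT.
  have e2 : `|v| / (2 * C) * C = `|v| / 2 by field; rewrite gt_eqF.
  by move=> /(ler_wpM2r (ltW Cp)); rewrite e2.
have : (C1 + C2) * t <= t * C.
  by rewrite mulrC ler_pM2l// /C (le_trans (ler_norm _))// lerDl.
lra.
Qed.

End first_order.

(** * Lie derivatives *)

Section endomorphism_derivative.
Variables (R : realType) (n : nat) (U : set 'rV[R]_n).
Hypothesis oU : open U.
Implicit Types (a b c d e : 'I_n) (x : 'rV[R]_n).
Local Notation mfield := ('rV[R]_n -> 'M[R]_n).
Variable G : 'I_n -> mfield.
Hypothesis sG : forall a, msmooth U (G a).

Lemma msmooth_endd a C : msmooth U C -> msmooth U (endd G a C).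
Proof.
move=> sC; apply: (msmoothD oU); last exact: (msmoothM oU).
apply: (msmoothD oU); first exact: msmooth_mpd.
by apply: (msmoothN oU); exact: (msmoothM oU).
Qed.

Lemma enddD a C D x : U x -> msmooth U C -> msmooth U D ->
  endd G a (fun y => C y + D y) x = endd G a C x + endd G a D x.
Proof. by move=> Ux sC sD; rewrite /endd (mpdD oU)//; mx_ring. Qed.

Lemma enddZ a (c : 'rV[R]_n -> R) C x : U x -> smooth_on U c -> msmooth U C ->
  endd G a (fun y => c y *: C y) x = pd a c x *: C x + c x *: endd G a C x.
Proof.
by move=> Ux sc sC; rewrite /endd (mpdZ oU)// !scalerDr; mx_ring.
Qed.

Lemma endd_sum a (C : 'I_n -> mfield) x : U x -> (forall e, msmooth U (C e)) ->
  endd G a (fun y => \sum_e C e y) x = \sum_e endd G a (C e) x.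
Proof.
move=> Ux sC; rewrite /endd (mpd_sum oU)// mulmx_sumr mulmx_suml.
by rewrite -sumrN -!big_split.
Qed.

Lemma endd_commutator a b C x : U x -> msmooth U C ->
  endd G a (endd G b C) x - endd G b (endd G a C) x =
  C x *m curv G a b x - curv G a b x *m C x.
Proof.
move=> Ux sC.
have E c d : mpd c (endd G d C) x = mpd c (mpd d C) x
    - (mpd c (G d) x *m C x + G d x *m mpd c C x)
    + (mpd c C x *m G d x + C x *m mpd c (G d) x).
  rewrite (mpdD oU) ?(mpdB oU) ?(mpdM oU)//.
  - exact: msmooth_mpd.
  - exact: (msmoothM oU).
  - apply: (msmoothD oU); first exact: msmooth_mpd.
    by apply: (msmoothN oU); exact: (msmoothM oU).
  - exact: (msmoothM oU).
have D c d : endd G c (endd G d C) x = mpd c (endd G d C) x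
    - G c x *m endd G d C x + endd G d C x *m G c x by [].
rewrite !D !E (mpdC oU b a)// /endd /curv; mx_ring.
Qed.

Variable Y : comp1 R n.
Hypothesis sY : forall e, smooth_on U (Y e).

Definition jacY x : 'M[R]_n := \matrix_(d, e) pd d (Y e) x.

Lemma msmooth_jacY : msmooth U jacY.
Proof.
move=> d e; apply: smooth_ext (smooth_pd d (sY e)) => // y _.
by rewrite [RHS]mxE.
Qed.

(** The Lie derivative along Y of the matrix-valued one-form F. *)
Definition lie_form (F : 'I_n -> mfield) a x : 'M[R]_n :=
  \sum_e (Y e x *: mpd e (F a) x + jacY x a e *: F e x).

(** The Lie derivative of the connection.  In the coordinate frame it is the Lie
derivative of the one-form G, corrected by the infinitesimal frame change d Y. *)
Definition lie_conn a x : 'M[R]_n := endd G a jacY x + lie_form G a x.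

Lemma msmooth_lie_term a e :
  msmooth U (fun y => Y e y *: mpd e (G a) y + jacY y a e *: G e y).
Proof.
apply: (msmoothD oU); apply: (msmoothZ oU) => //; last exact: msmooth_jacY.
exact: msmooth_mpd.
Qed.

Lemma msmooth_lie_form a : msmooth U (lie_form G a).
Proof. by apply: (msmooth_sum oU) => e; exact: msmooth_lie_term. Qed.

Lemma msmooth_lie_conn a : msmooth U (lie_conn a).
Proof.
apply: (msmoothD oU); last exact: msmooth_lie_form.
by apply: msmooth_endd; exact: msmooth_jacY.
Qed.

Lemma mpd_curv e a b x : U x -> mpd e (curv G a b) x =
  mpd e (mpd a (G b)) x - mpd e (mpd b (G a)) x
  - (mpd e (G a) x *m G b x + G a x *m mpd e (G b) x)
  + (mpd e (G b) x *m G a x + G b x *m mpd e (G a) x).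
Proof.
move=> Ux; have sm c d : msmooth U (mpd c (G d)) by exact: msmooth_mpd.
have sM c d : msmooth U (fun y => G c y *m G d y) by exact: (msmoothM oU).
have sB c d : msmooth U (fun y => mpd c (G d) y - mpd d (G c) y).
  by apply: (msmoothD oU) => //; exact: (msmoothN oU).
rewrite (mpdD oU)//; last by apply: (msmoothD oU) => //; exact: (msmoothN oU).
by rewrite !(mpdB oU)// !(mpdM oU).
Qed.

Lemma pd_jacY a b e x : U x ->
  pd a (fun y => jacY y b e) x = pd b (fun y => jacY y a e) x.
Proof.
move=> Ux; have E c : (fun y => jacY y c e) = pd c (Y e).
  by apply/funext => y; rewrite mxE.
rewrite !E; exact: (pdC a b oU (sY e) Ux).
Qed.

(** For a single index e the identity holds without summation, as a consequence of
the symmetry of second derivatives. *)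
Lemma lie_curvature_term a b e x : U x ->
  endd G a (fun y => Y e y *: mpd e (G b) y + jacY y b e *: G e y) x
  - endd G b (fun y => Y e y *: mpd e (G a) y + jacY y a e *: G e y) x
  = Y e x *: mpd e (curv G a b) x
    + (jacY x a e *: curv G e b x + jacY x b e *: curv G a e x).
Proof.
move=> Ux; have sm c d : msmooth U (mpd c (G d)) by exact: msmooth_mpd.
have T c d : endd G c (fun y => Y e y *: mpd e (G d) y + jacY y d e *: G e y) x
  = jacY x c e *: mpd e (G d) x + Y e x *: endd G c (mpd e (G d)) x
  + (pd c (fun y => jacY y d e) x *: G e x + jacY x d e *: endd G c (G e) x).
  rewrite enddD//; try by apply: (msmoothZ oU) => //; exact: msmooth_jacY.
  rewrite enddZ// enddZ//; last exact: msmooth_jacY.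
  by rewrite [jacY x c e]mxE.
rewrite !T (pd_jacY b a)// mpd_curv// /endd (mpdC oU a e)// (mpdC oU b e)//.
rewrite /curv.
move: (pd a _ x) (Y e x) (jacY x a e) (jacY x b e) => p y ja jb.
mx_normalize; rewrite ?scalerDr ?scalerN; mx_linear.
Qed.

(** The first variation of the curvature under G -> G + L_Y G is the Lie derivative
of the curvature.  The part [endd a jacY] of [lie_conn] contributes the
commutator of the curvature with d Y, the part [lie_form G a] the rest. *)
Lemma lie_curvature a b x : U x ->
  endd G a (lie_conn b) x - endd G b (lie_conn a) x =
  \sum_e (Y e x *: mpd e (curv G a b) x
          + (jacY x a e *: curv G e b x + jacY x b e *: curv G a e x))
  + (jacY x *m curv G a b x - curv G a b x *m jacY x).
Proof.
move=> Ux.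
have E c d : endd G c (lie_conn d) x = endd G c (endd G d jacY) x
    + \sum_e endd G c (fun y => Y e y *: mpd e (G d) y + jacY y d e *: G e y) x.
  rewrite enddD//; last 2 first.
  - by apply: msmooth_endd; exact: msmooth_jacY.
  - exact: msmooth_lie_form.
  by rewrite endd_sum// => e; exact: msmooth_lie_term.
rewrite !E opprD addrACA endd_commutator//; last exact: msmooth_jacY.
rewrite addrC; congr (_ + _); rewrite -sumrB; apply: eq_bigr => e _.
exact: lie_curvature_term.
Qed.

End endomorphism_derivative.

Section lie_metric.
Variables (R : realType) (n : nat) (U : set 'rV[R]_n).
Hypothesis oU : open U.
Implicit Types (a b c d e : 'I_n) (x : 'rV[R]_n).
Variable g : comp2 R n.
Hypothesis sg : smooth2 U g.
Hypothesis gsym : sym2 U g.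
Hypothesis gunit : forall x, U x -> gram g x \in unitmx.
Variable Y : comp1 R n.
Hypothesis sY : forall e, smooth_on U (Y e).

Local Notation G := (conn g).
Local Notation gm := (gram g).
Local Notation B := (jacY Y).
Local Notation L := (lie_deriv Y g).

Let sG a : msmooth U (G a) := msmooth_conn oU sg gsym gunit a.
Let sB : msmooth U B := msmooth_jacY oU sY.
Let sgm : msmooth U gm := msmooth_gram sg.

Lemma gram_lie x : U x -> gram L x =
  \sum_e Y e x *: mpd e gm x + B x *m gm x + gm x *m (B x)^T.
Proof.
move=> Ux; apply/matrixP => a b.
have mE (X1 X2 X3 : 'M[R]_n) : (X1 + X2 + X3) a b = X1 a b + X2 a b + X3 a b.
  by rewrite !mxE.
rewrite mE mxE summxE 2!mxE -!big_split; apply: eq_bigr => c _ /=.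
have -> : (Y c x *: mpd c gm x) a b = Y c x * pd c (g a b) x.
  by rewrite mxE mpd_gram.
by rewrite !mxE; ring.
Qed.

(** Obtained by applying L_Y to d_a g = G_a g + g G_a^T. *)
Lemma covd_lie a x : U x ->
  covd G a (gram L) x = lie_conn G Y a x *m gm x + (lie_conn G Y a x *m gm x)^T.
Proof.
move=> Ux.
have sT e : msmooth U (fun y => Y e y *: mpd e gm y).
  by apply: (msmoothZ oU) => //; exact: msmooth_mpd.
have sS : msmooth U (fun y => \sum_e Y e y *: mpd e gm y) by exact:
    (msmooth_sum oU).
have sBg : msmooth U (fun y => B y *m gm y) by exact: (msmoothM oU).
have sgB : msmooth U (fun y => gm y *m (B y)^T).
  by apply: (msmoothM oU) => //; exact: msmoothT.
rewrite (covd_ext (T' := fun y => (\sum_e Y e y *: mpd e gm y + B y *m gm y)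
    + gm y *m (B y)^T) oU _ a Ux); last exact: gram_lie.
rewrite (covdD oU)//; last exact: (msmoothD oU).
rewrite (covdD oU)// (covdM oU)// (covd_gram oU gsym gunit)// mulmx0 addr0.
have -> : covd G a (fun y => gm y *m (B y)^T) x = (endd G a B x *m gm x)^T.
  have gT y : U y -> (gm y)^T = gm y by move=> Uy; exact: gramT gsym Uy.
  transitivity (covd G a (fun y => (B y *m gm y)^T) x).
    by apply: (covd_ext oU) => // y Uy; rewrite trmx_mul gT.
  have -> : endd G a B x *m gm x = covd G a (fun y => B y *m gm y) x.
    by rewrite (covdM oU)// (covd_gram oU gsym gunit)// mulmx0 addr0.
  by rewrite /covd (mpdT oU)//; mx_ring.
have met e y : U y -> mpd e gm y = G e y *m gm y + gm y *m (G e y)^T.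
  move=> Uy; have := covd_gram oU gsym gunit e Uy.
  by rewrite /covd => /eqP; rewrite subr_eq0 subr_eq addrC => /eqP.
have -> : covd G a (fun y => \sum_e Y e y *: mpd e gm y) x =
   lie_form Y G a x *m gm x + gm x *m (lie_form Y G a x)^T.
  rewrite /covd (mpd_sum oU)// mulmx_sumr mulmx_suml -!sumrB.
  have -> : (lie_form Y G a x)^T =
      \sum_e (Y e x *: mpd e (G a) x + B x a e *: G e x)^T.
    by rewrite /lie_form raddf_sum.
  rewrite /lie_form mulmx_suml mulmx_sumr -big_split; apply: eq_bigr => e _ /=.
  rewrite (mpdZ oU)//; last exact: msmooth_mpd.
  rewrite (mpdC oU a e)//.
  rewrite (mpd_ext (G := fun y => G a y *m gm y + gm y *m (G a y)^T) oU e Ux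
      (met a)).
  have sGT : msmooth U (fun y => (G a y)^T) by exact: msmoothT.
  rewrite (mpdD oU) ?(mpdM oU) ?(mpdT oU)//; try exact: (msmoothM oU).
  have -> : B x a e = pd a (Y e) x by rewrite mxE.
  rewrite {1}(met e x Ux); move: (pd a _ _) (Y e x) => p y.
  mx_normalize; rewrite ?scalerDr ?scalerN; mx_linear.
rewrite /lie_conn; move: (endd _ _ _ _) (lie_form _ _ _ _) (gm x) (gramT gsym
    Ux) => X1 X2 X3 XT.
by rewrite !trmx_mul !mulmxDl trmxD !XT mulmxDr; mx_ring.
Qed.

Lemma lie_conn_sym a b c x : U x -> lie_conn G Y a x b c = lie_conn G Y b x a c.
Proof.
move=> Ux; have E a' b' : lie_conn G Y a' x b' c =
    pd a' (pd b' (Y c)) x - \sum_e G a' x b' e * B x e c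
    + \sum_e B x b' e * G a' x e c
    + (\sum_e Y e x * mpd e (G a') x b' c + \sum_e B x a' e * G e x b' c).
  have mE (X1 X2 : 'M[R]_n) : (X1 + X2) b' c =
      X1 b' c + X2 b' c by rewrite !mxE.
  have mB (X1 X2 : 'M[R]_n) : (X1 - X2) b' c =
      X1 b' c - X2 b' c by rewrite !mxE.
  rewrite /lie_conn /endd mE mE mB [(G a' x *m B x) b' c]mxE [(B x *m G a' x)
      b' c]mxE.
  congr (_ - _ + _ + _).
    rewrite mpdE; congr (pd a' _ x); apply/funext => y; exact: mxE.
  rewrite /lie_form summxE -big_split; apply: eq_bigr => e _ /=.
  by rewrite mE; congr (_ + _); rewrite mxE.
rewrite !E (pdC a b oU (sY c) Ux).
have -> : \sum_e G a x b e * B x e c = \sum_e G b x a e * B x e c.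
  by apply: eq_bigr => e _; rewrite (conn_sym oU gsym a b).
have -> : \sum_e Y e x * mpd e (G a) x b c = \sum_e Y e x * mpd e (G b) x a c.
  apply: eq_bigr => e _; congr (_ * _); rewrite !mpdE.
  by apply: (pd_ext e oU Ux) => y Uy; exact: (conn_sym oU gsym).
have -> : \sum_e B x b e * G a x e c = \sum_e B x b e * G e x a c.
  by apply: eq_bigr => e _; rewrite (conn_sym oU gsym a e).
have -> : \sum_e B x a e * G e x b c = \sum_e B x a e * G b x e c.
  by apply: eq_bigr => e _; rewrite (conn_sym oU gsym b e).
ring.
Qed.

(** The connection of g varies by L_Y G when g varies by L_Y g: both sides solve
the Koszul equations for nabla (L_Y g). *)
Lemma lie_conn_gram a x : U x -> lie_conn G Y a x *m gm x = dconn_low g L a x.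
Proof.
move=> Ux; apply: (@koszul_unique _ _ _ (fun b =>
    lie_conn G Y b x *m gm x)) => [b|b c d].
  by rewrite covd_lie.
rewrite mxE [RHS]mxE; apply: eq_bigr => e _; congr (_ * _).
exact: lie_conn_sym.
Qed.

Lemma dcurv_low_lie a b x : U x ->
  dcurv_low g L a b x = (endd G a (lie_conn G Y b) x - endd G b (lie_conn G Y
      a) x) *m gm x.
Proof.
move=> Ux; have sD c := msmooth_lie_conn oU sG sY c.
have E c d : covd G c (dconn_low g L d) x = endd G c (lie_conn G Y d) x *m gm x.
  rewrite (covd_ext (T' := fun y => lie_conn G Y d y *m gm y) oU _ c Ux).
    by rewrite (covdM oU)// (covd_gram oU gsym gunit)// mulmx0 addr0.
  by move=> y Uy; rewrite lie_conn_gram.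
by rewrite /dcurv_low !E mulmxBl.
Qed.

(** The right-hand side is the Lie derivative of the Ricci tensor.  It is the trace
of [lie_curvature], in which the terms with d Y on the traced indices cancel. *)
Lemma dricci_lie b d x : U x -> dricci g L b d x =
  \sum_e (Y e x * pd e (ricci g b d) x + ricci g e d x * pd b (Y e) x
          + ricci g b e x * pd d (Y e) x).
Proof.
move=> Ux; have sc a := msmooth_curv oU sG a.
have E a : (dcurv_low g L a b x *m invmx (gm x)) d a =
   \sum_e (Y e x * mpd e (curv G a b) x d a + B x b e * curv G a e x d a
   + B x a e * curv G e b x d a)
   + (\sum_e B x d e * curv G a b x e a - \sum_e curv G a b x d e * B x e a).
  rewrite dcurv_low_lie// mulmxK ?gunit// (lie_curvature oU sG sY)//.
  have mE (X1 X2 X3 : 'M[R]_n) : (X1 + (X2 - X3)) d a =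
      X1 d a + (X2 d a - X3 d a).
    by rewrite !mxE.
  rewrite mE [(B x *m _) _ _]mxE [(_ *m B x) _ _]mxE; congr (_ + _).
  rewrite summxE; apply: eq_bigr => e _.
  have mD (X1 X2 X3 : 'M[R]_n) (u v w : R) :
    (u *: X1 + (v *: X2 + w *: X3)) d a = u * X1 d a + w * X3 d a + v * X2 d a.
    by rewrite !mxE; ring.
  by rewrite mD.
rewrite /dricci; under eq_bigr do rewrite E.
rewrite big_split sumrB /= (exchange_big _ _ _ _ _ (fun a e =>
    curv G a b x d e * B x e a)) /=.
rewrite exchange_big /=.
rewrite [X in _ + (X - _)]exchange_big /=.
have -> : \sum_i \sum_j (Y i x * mpd i (curv G j b) x d j + B x b i * curv G j
    i x d j
     + B x j i * curv G i b x d j) =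
   \sum_i (Y i x * pd i (ricci g b d) x + ricci g i d x * pd b (Y i) x
          + \sum_j B x j i * curv G i b x d j).
  apply: eq_bigr => e _; rewrite !big_split /=; congr (_ + _ + _).
    rewrite -mulr_sumr; congr (_ * _).
    rewrite (pd_ext e oU Ux (k := fun y => \sum_j curv G j b y d j));
        last first.
      by move=> y Uy; rewrite (ricciE oU gsym).
    rewrite pd_sum; first by apply: eq_bigr => j _; rewrite mpdE.
    by move=> j; exact: msmooth_derivable (sc j b) Ux.
  rewrite -mulr_sumr (ricciE oU gsym)// mulrC; congr (_ * _); exact: mxE.
rewrite big_split /= -addrA [X in _ + X]addrCA.
have -> : \sum_i \sum_j B x j i * curv G i b x d j =
   \sum_j \sum_i curv G i b x d j * B x j i.
  rewrite exchange_big; apply: eq_bigr => j _; apply: eq_bigr => i _;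
      exact: mulrC.
rewrite subrr addr0 -big_split; apply: eq_bigr => e _ /=.
rewrite (ricciE oU gsym b e)//; congr (_ + _).
rewrite [RHS]mulr_suml; apply: eq_bigr => a _.
by rewrite mxE mulrC.
Qed.

Lemma dricci_lie_einstein (lam : R) b d x :
  (forall b d x, U x -> ricci g b d x = lam * g b d x) -> U x ->
  dricci g L b d x = lam * L b d x.
Proof.
move=> ein Ux; rewrite dricci_lie// mulr_sumr; apply: eq_bigr => e _.
rewrite !ein// (pd_ext e oU Ux (k := fun y => lam * g b d y)); last first.
  by move=> y Uy; rewrite ein.
rewrite pdM ?pd_cst; first by ring.
- exact: derivable_cst.
- exact: smooth_derivable (sg b d) Ux.
Qed.

(** The factor 2 is there because L_Y g_ab = 2 nabla_(a Y_b). *)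
Lemma killing_lie (X : comp1 R n) :
  (forall b x, U x -> X b x = 2 * \sum_c g b c x * Y c x) ->
  forall a b x, U x -> killing g X a b x = L a b x.
Proof.
move=> XY a b x Ux.
have dg i j k : derivable (g i j) x 'e_k := smooth_derivable (sg i j) Ux.
have dY i k : derivable (Y i) x 'e_k := smooth_derivable (sY i) Ux.
have pX a' b' : pd a' (X b') x =
   2 * \sum_c (pd a' (g b' c) x * Y c x + g b' c x * pd a' (Y c) x).
  rewrite (pd_ext a' oU Ux (XY b')) pdM ?pd_cst ?mul0r ?add0r; last 2 first.
  - exact: derivable_cst.
  - exact: smooth_derivable (smooth_sum _ _ oU (fun c =>
      smoothM oU (sg b' c) (sY c))) Ux.
  congr (_ * _); rewrite pd_sum; last by move=> c; exact: derivableM.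
  by apply: eq_bigr => c _; rewrite pdM.
have GX a' b' : \sum_e christoffel g e a' b' x * X e x =
   \sum_c (pd a' (g b' c) x + pd b' (g a' c) x - pd c (g a' b') x) * Y c x.
  transitivity (2 * \sum_c (G a' x *m gm x) b' c * Y c x).
    rewrite mulr_sumr; under eq_bigr do rewrite XY// christoffelE.
    under [RHS]eq_bigr do rewrite mxE mulr_suml mulr_sumr.
    rewrite exchange_big; apply: eq_bigr => e _ /=.
    rewrite mulrCA !mulr_sumr; apply: eq_bigr => c _; rewrite mxE; ring.
  rewrite mulr_sumr; apply: eq_bigr => c _.
  rewrite (conn_gram gsym gunit)// mxE !mpd_gram; lra.
have M (F : 'I_n -> R) : 2 * (\sum_c F c) = \sum_c 2 * F c by rewrite mulr_sumr.
rewrite /killing /nabla_cov1 !pX !GX !M -!sumrB -big_split mulr_sumr.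
apply: eq_bigr => c _ /=.
have -> : pd c (g b a) x = pd c (g a b) x.
  by apply: (pd_ext c oU Ux) => y Uy; exact: gsym.
rewrite (gsym c b Ux); lra.
Qed.

End lie_metric.

(** * Changes of coordinates *)

Section change_of_coordinates.
Variables (R : realType) (n : nat) (U V : set 'rV[R]_n).
Hypotheses (oU : open U) (oV : open V).
Implicit Types (a b c d e p q : 'I_n) (x : 'rV[R]_n).
Variable psi : 'rV[R]_n -> 'rV[R]_n.
Hypothesis spsi : forall b, smooth_on U (fun y => psi y 0 b).
Hypothesis UV : forall x, U x -> V (psi x).

(** The Jacobian of psi, in the index convention of [jac]. *)
Definition jacm x : 'M[R]_n := \matrix_(a, b) pd a (fun y => psi y 0 b) x.
Local Notation J := jacm.
Hypothesis Junit : forall x, U x -> J x \in unitmx.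

Lemma jacmE a b x : J x a b = pd a (fun y => psi y 0 b) x.
Proof. exact: mxE. Qed.

Lemma msmooth_jacm : msmooth U J.
Proof.
move=> a b; apply: smooth_ext (smooth_pd a (spsi b)) => // y _.
by rewrite jacmE.
Qed.

Lemma smooth_jacm_entry a b : smooth_on U (fun y => J y a b).
Proof. exact: msmooth_jacm. Qed.

Lemma pd_jacmC a b c x : U x ->
  pd a (fun y => J y b c) x = pd b (fun y => J y a c) x.
Proof.
move=> Ux; have E d : (fun y => J y d c) = pd d (fun y => psi y 0 c).
  by apply/funext => y; rewrite jacmE.
rewrite !E; exact: (pdC a b oU (spsi c) Ux).
Qed.

Lemma msmooth_comp r s (N : 'rV[R]_n -> 'M[R]_(r, s)) :
  msmooth V N -> msmooth U (fun y => N (psi y)).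
Proof. by move=> sN i j; exact: (smooth_comp oU oV (sN i j)). Qed.

Lemma mpd_comp r s (N : 'rV[R]_n -> 'M[R]_(r, s)) a x : U x -> msmooth V N ->
  mpd a (fun y => N (psi y)) x = \sum_d J x a d *: mpd d N (psi x).
Proof.
move=> Ux sN; apply/matrixP => i j; rewrite mpdE summxE.
have [|_ ->] := derivable_pd_comp (a := a) oV (sN i j) (UV Ux).
  by move=> b; exact: smooth_derivable (spsi b) Ux.
by apply: eq_bigr => d _; rewrite [RHS]mxE jacmE mpdE.
Qed.

(** Used to carry the symmetry of Christoffel-like arrays through a change of
coordinates. *)
Lemma jacm_contract_sym r (N : 'I_n -> 'M[R]_(n, r)) b p (q : 'I_r) x :
  (forall d e (k : 'I_r), N d e k = N e d k) ->
  (\sum_d J x b d *: (J x *m N d)) p q = (\sum_d J x p d *: (J x *m N d)) b q.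
Proof.
move=> sN; rewrite !summxE.
have E s t : \sum_d (J x s d *: (J x *m N d)) t q =
   \sum_d \sum_e J x s d * (J x t e * N d e q).
  by apply: eq_bigr => d _; rewrite [LHS]mxE [X in _ * X]mxE mulr_sumr.
rewrite !E exchange_big; apply: eq_bigr => d _; apply: eq_bigr => e _ /=.
by rewrite sN mulrCA.
Qed.

Variables g g' : comp2 R n.
Hypotheses (sg : smooth2 U g) (gsym : sym2 U g).
Hypothesis gunit : forall x, U x -> gram g x \in unitmx.
Hypotheses (sg' : smooth2 V g') (gsym' : sym2 V g').
Hypothesis gunit' : forall x, V x -> gram g' x \in unitmx.
Hypothesis gJ : forall x, U x -> gram g x = J x *m gram g' (psi x) *m (J x)^T.

Local Notation G := (conn g).
Local Notation G' := (conn g').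

Let sG a : msmooth U (G a) := msmooth_conn oU sg gsym gunit a.
Let sG' a : msmooth V (G' a) := msmooth_conn oV sg' gsym' gunit' a.
Let sJ : msmooth U J := msmooth_jacm.

(** The connection of g' as a one-form pulled back by psi, still expressed in the
coordinate frame of the target. *)
Definition pullconn a x : 'M[R]_n := \sum_d J x a d *: G' d (psi x).

Lemma mpd_pullback a (T : 'rV[R]_n -> 'M[R]_n) x : U x -> msmooth V T ->
  mpd a (fun y => J y *m T (psi y) *m (J y)^T) x =
  mpd a J x *m T (psi x) *m (J x)^T
  + J x *m (\sum_d J x a d *: mpd d T (psi x)) *m (J x)^T
  + J x *m T (psi x) *m (mpd a J x)^T.
Proof.
move=> Ux sT; have sTp := msmooth_comp sT.
rewrite (mpdM oU)//; last exact: msmoothT; last exact: (msmoothM oU).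
by rewrite (mpdM oU)// (mpdT oU)// mpd_comp// mulmxDl.
Qed.

(** The inhomogeneous transformation law of the Christoffel symbols, as a gauge
transformation by J. *)
Lemma conn_pullback a x : U x ->
  G a x *m J x = J x *m pullconn a x + mpd a J x.
Proof.
move=> Ux; have Vx := UV Ux; have sgm' := msmooth_gram sg'.
(* Q b is the transported connection times the metric; by uniqueness it is the
   Christoffel symbol of g with its upper index lowered. *)
pose Q b := (J x *m pullconn b x + mpd b J x) *m (gram g' (psi x) *m (J x)^T).
have QE b : Q b = koszul (fun c => mpd c (gram g) x) b.
  apply: koszul_unique => [c|c d e].
    rewrite (mpd_ext oU c Ux gJ) mpd_pullback//.
    have -> : \sum_d J x c d *: mpd d (gram g') (psi x) =
       pullconn c x *m gram g' (psi x) + gram g' (psi x) *m (pullconn c x)^T.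
      have -> : (pullconn c x)^T = \sum_d (J x c d *: G' d (psi x))^T.
        by rewrite /pullconn raddf_sum.
      rewrite /pullconn mulmx_suml mulmx_sumr -big_split; apply: eq_bigr =>
          d _ /=.
      have := covd_gram oV gsym' gunit' d Vx; rewrite /covd => /eqP.
      rewrite subr_eq0 subr_eq => /eqP ->.
      by rewrite trmxZ -scalemxAl -scalemxAr scalerDr addrC.
    rewrite /Q; have gT := gramT gsym' Vx.
    rewrite !trmx_mul trmxD trmxK gT !trmx_mul.
    move: (gram g' _) (pullconn _ _) (J x) => X1 X2 X3; mx_ring.
  rewrite /Q !mulmxDl mxE [RHS]mxE; congr (_ + _); last first.
    rewrite mxE [RHS]mxE; apply: eq_bigr => f _; congr (_ * _).
    by rewrite !mpdE pd_jacmC.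
  have E s : J x *m pullconn s x *m (gram g' (psi x) *m (J x)^T) =
    \sum_d J x s d *: (J x *m (G' d (psi x) *m (gram g' (psi x) *m (J x)^T))).
    rewrite /pullconn mulmx_sumr mulmx_suml; apply: eq_bigr => k _.
    by rewrite -scalemxAr -scalemxAl !mulmxA.
  rewrite !E; apply: jacm_contract_sym => i j k; rewrite mxE [RHS]mxE.
  by apply: eq_bigr => l _; rewrite (conn_sym oV gsym' i j).
have u : gram g' (psi x) *m (J x)^T \in unitmx.
  by rewrite unitmx_mul gunit'//= unitmx_tr Junit.
have := conn_gram gsym gunit a Ux; rewrite -QE gJ// -[J x *m _ *m _]mulmxA
    mulmxA.
by move=> /(congr1 (fun A => A *m invmx (gram g' (psi x) *m (J x)^T)));
    rewrite !mulmxK.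
Qed.

(** The term d_a J of [conn_pullback] cancels the derivative of the factors J. *)
Lemma covd_pullback a (T : 'rV[R]_n -> 'M[R]_n) x : U x -> msmooth V T ->
  covd G a (fun y => J y *m T (psi y) *m (J y)^T) x =
  \sum_d J x a d *: (J x *m covd G' d T (psi x) *m (J x)^T).
Proof.
move=> Ux sT; rewrite {1}/covd mpd_pullback//.
have -> : G a x *m (J x *m T (psi x) *m (J x)^T) =
   (G a x *m J x) *m T (psi x) *m (J x)^T by rewrite !mulmxA.
have -> : J x *m T (psi x) *m (J x)^T *m (G a x)^T =
   J x *m T (psi x) *m (G a x *m J x)^T by rewrite trmx_mul !mulmxA.
rewrite conn_pullback//.
have -> : \sum_d J x a d *: (J x *m covd G' d T (psi x) *m (J x)^T) =
   J x *m (\sum_d J x a d *: mpd d T (psi x) - pullconn a x *m T (psi x)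
           - T (psi x) *m (pullconn a x)^T) *m (J x)^T.
  have -> : (pullconn a x)^T = \sum_d (J x a d *: G' d (psi x))^T.
    by rewrite /pullconn raddf_sum.
  rewrite /pullconn mulmx_suml mulmx_sumr -!sumrB mulmx_sumr mulmx_suml.
  apply: eq_bigr => d _.
  by rewrite trmxZ -!scalemxAl -!scalemxAr -!scalerBr -scalemxAr -scalemxAl.
move: (pullconn a x) (\sum_d J x a d *: mpd d T (psi x)) (J x) (T (psi x)) =>
    X1 X2 X3 X4; mx_ring.
Qed.

Lemma invgram_pullback x : U x ->
  (J x)^T *m invmx (gram g x) = invmx (gram g' (psi x)) *m invmx (J x).
Proof.
move=> Ux; have Vx := UV Ux.
have uT : (J x)^T \in unitmx by rewrite unitmx_tr Junit.
have e : (J x)^T *m invmx (gram g x) *m (J x *m gram g' (psi x)) = 1%:M.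
  have {1}-> : J x *m gram g' (psi x) = gram g x *m invmx ((J x)^T).
    by rewrite gJ// mulmxK.
  by rewrite mulmxA mulmxKV ?mulmxV// gunit.
have uJ : J x \in unitmx by exact: Junit.
have ug : gram g' (psi x) \in unitmx by exact: gunit'.
transitivity ((J x)^T *m invmx (gram g x) *m (J x *m gram g' (psi x))
   *m (invmx (gram g' (psi x)) *m invmx (J x))); last by rewrite e mul1mx.
by rewrite -mulmxA -(mulmxA (J x)) (mulmxA (gram g' _)) mulmxV// mul1mx
    mulmxV// mulmx1.
Qed.

Section tensor.
Variables h h' : comp2 R n.
Hypotheses (sh : smooth2 U h) (hsym : sym2 U h).
Hypotheses (sh' : smooth2 V h') (hsym' : sym2 V h').
Hypothesis hJ : forall x, U x -> gram h x = J x *m gram h' (psi x) *m (J x)^T.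

Local Notation N e := (fun y => J y *m dconn_low g' h' e (psi y) *m (J y)^T).

Let sS' e : msmooth V (dconn_low g' h' e) :=
    msmooth_dconn_low oV sg' gsym' gunit' sh' e.

Lemma msmooth_pullback (T : 'rV[R]_n -> 'M[R]_n) : msmooth V T ->
  msmooth U (fun y => J y *m T (psi y) *m (J y)^T).
Proof.
move=> sT; apply: (msmoothM oU); last exact: msmoothT.
by apply: (msmoothM oU) => //; exact: msmooth_comp.
Qed.

Lemma dconn_low_pullback b x : U x ->
  dconn_low g h b x = \sum_e J x b e *: (J x *m dconn_low g' h' e (psi x) *m (J
      x)^T).
Proof.
move=> Ux; have Vx := UV Ux; apply/esym.
have sK' a : (covd G' a (gram h') (psi x))^T = covd G' a (gram h') (psi x).
  by apply: (covdT oV) => // y Vy; exact: gramT hsym' Vy.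
apply: (@koszul_unique _ _ _
  (fun b => \sum_e J x b e *: (J x *m dconn_low g' h' e (psi x) *m (J x)^T)))
      => [c|c d f].
  rewrite raddf_sum -big_split /=.
  rewrite (covd_ext (T' := fun y => J y *m gram h' (psi y) *m (J y)^T) oU _ c
      Ux)//.
  rewrite covd_pullback//; last exact: msmooth_gram.
  apply: eq_bigr => e _.
  have <- := @koszul_addT _ _ (fun a => covd G' a (gram h') (psi x)) e (sK').
  rewrite -/(dconn_low g' h' e (psi x)) trmxZ -scalerDr; congr (_ *: _).
  by rewrite !trmx_mul trmxK mulmxDr mulmxDl !mulmxA.
have E s : \sum_e J x s e *: (J x *m dconn_low g' h' e (psi x) *m (J x)^T) =
   \sum_e J x s e *: (J x *m (dconn_low g' h' e (psi x) *m (J x)^T)).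
  by apply: eq_bigr => e _; rewrite mulmxA.
rewrite !E; apply: jacm_contract_sym => e k r; rewrite mxE [RHS]mxE.
by apply: eq_bigr => l _; congr (_ * _); exact: koszul_sym.
Qed.

Lemma covd_dconn_low_pullback a b x : U x -> covd G a (dconn_low g h b) x =
  \sum_e (pd a (fun y => J y b e) x *: N e x
   + J x b e *: \sum_d J x a d *: (J x *m covd G' d (dconn_low g' h' e) (psi x)
       *m (J x)^T)).
Proof.
move=> Ux.
have sN e : msmooth U (N e) by exact: msmooth_pullback.
rewrite (covd_ext (T' := fun y => \sum_e J y b e *: N e y) oU _ a Ux);
    last first.
  by move=> y Uy; rewrite dconn_low_pullback.
rewrite /covd (mpd_sum oU)//; last first.
  by move=> e; apply: (msmoothZ oU) => //; exact: smooth_jacm_entry.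
rewrite mulmx_sumr mulmx_suml -!sumrB; apply: eq_bigr => e _.
rewrite (mpdZ oU a Ux (smooth_jacm_entry b e) (sN e)).
by rewrite -covd_pullback// -scalemxAl -scalemxAr /covd !scalerBr !addrA.
Qed.

(** The second derivatives of psi cancel in the antisymmetrisation. *)
Lemma dcurv_low_pullback a b x : U x -> dcurv_low g h a b x =
  \sum_e \sum_d (J x b e * J x a d) *: (J x *m dcurv_low g' h' d e (psi x) *m
      (J x)^T).
Proof.
move=> Ux; rewrite /dcurv_low !covd_dconn_low_pullback// !big_split /=.
have -> : \sum_e pd a (fun y => J y b e) x *: N e x =
          \sum_e pd b (fun y => J y a e) x *: N e x.
  by apply: eq_bigr => e _; rewrite pd_jacmC.
rewrite opprD addrACA subrr add0r.
have E s t (M : 'I_n -> 'I_n -> 'M[R]_n) :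
  \sum_e J x s e *: \sum_d J x t d *: M d e =
      \sum_e \sum_d (J x s e * J x t d) *: M d e.
  by apply: eq_bigr => e _; rewrite scaler_sumr; apply: eq_bigr => d _;
      rewrite scalerA.
rewrite !E [X in _ - X]exchange_big /= -sumrB; apply: eq_bigr => e _.
rewrite -sumrB; apply: eq_bigr => d _.
by rewrite [J x a d * _]mulrC -scalerBr -mulmxBl -mulmxBr.
Qed.

Lemma dricci_pullback b q x : U x -> dricci g h b q x =
  \sum_e \sum_p J x b e * J x q p * dricci g' h' e p (psi x).
Proof.
move=> Ux; have Vx := UV Ux.
have inv := invgram_pullback Ux.
pose M d e := dcurv_low g' h' d e (psi x) *m invmx (gram g' (psi x)).
have E a : (dcurv_low g h a b x *m invmx (gram g x)) q a =
    \sum_e \sum_d J x b e * ((J x *m M d e *m invmx (J x)) q a * J x a d).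
  rewrite dcurv_low_pullback// mulmx_suml summxE; apply: eq_bigr => e _.
  rewrite mulmx_suml summxE; apply: eq_bigr => d _.
  rewrite -scalemxAl -[X in _ *: X]mulmxA inv [LHS]mxE -mulrA; congr (_ * _).
  by rewrite mulrC; congr (_ * _); rewrite /M !mulmxA.
rewrite /dricci; under eq_bigr do rewrite E.
rewrite exchange_big; apply: eq_bigr => e _ /=.
rewrite exchange_big /=.
transitivity (J x b e * \sum_d (J x *m M d e) q d).
  rewrite mulr_sumr; apply: eq_bigr => d _; rewrite -mulr_sumr; congr (_ * _).
  rewrite -[J x *m M d e in RHS](mulmxKV (Junit Ux)) [RHS]mxE.
  by apply: eq_bigr => a _; rewrite -!mulmxA.
have -> : \sum_d (J x *m M d e) q d = \sum_d \sum_p J x q p * M d e p d.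
  by apply: eq_bigr => d _; rewrite mxE.
rewrite exchange_big mulr_sumr; apply: eq_bigr => p _ /=.
by rewrite -mulr_sumr mulrA.
Qed.

End tensor.

Lemma nabla_cov1E (f : comp2 R n) (X : comp1 R n) a b x :
  nabla_cov1 f X a b x =
  (mpd a (fun y => \col_c X c y) x - conn f a x *m \col_c X c x) b 0.
Proof.
rewrite [RHS]mxE [X in _ + X]mxE mxE mpdE /nabla_cov1; congr (_ - _).
  by congr (pd a _ x); apply/funext => y; rewrite mxE.
by apply: eq_bigr => e _; rewrite christoffelE [in RHS]mxE.
Qed.

Lemma killing_pullback (X X' : comp1 R n) a b x :
  (forall b, smooth_on V (X' b)) ->
  (forall b y, U y -> X b y = \sum_c J y b c * X' c (psi y)) -> U x ->
  killing g X a b x =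
  \sum_d \sum_e J x a d * J x b e * killing g' X' d e (psi x).
Proof.
move=> sX' XX Ux; pose C' y := \col_c X' c y.
have sC' : msmooth V C'.
  by move=> i j; apply: smooth_ext (sX' i) => // y _; rewrite mxE.
have N a' b' : nabla_cov1 g X a' b' x =
    \sum_d \sum_e J x a' d * J x b' e * nabla_cov1 g' X' d e (psi x).
  have XC y : U y -> \col_c X c y = J y *m C' (psi y).
    move=> Uy; apply/colP => i; rewrite !mxE XX//.
    by apply: eq_bigr => c _; rewrite [C' _ _ _]mxE.
  rewrite nabla_cov1E (mpd_ext oU a' Ux XC) XC//.
  rewrite (mpdM oU)//; last exact: msmooth_comp.
  rewrite mpd_comp// mulmxA conn_pullback//.
  have -> : mpd a' J x *m C' (psi x) + J x *m (\sum_d J x a' d *: mpd d C' (psi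
      x))
     - (J x *m pullconn a' x + mpd a' J x) *m C' (psi x) =
     \sum_d J x a' d *: (J x *m (mpd d C' (psi x) - G' d (psi x) *m C' (psi
         x))).
    rewrite mulmxDl [X in _ - X]addrC opprD addrACA subrr add0r -mulmxA
        -mulmxBr.
    rewrite /pullconn mulmx_suml -sumrB mulmx_sumr; apply: eq_bigr => d _.
    by rewrite -scalemxAl -scalerBr -scalemxAr.
  rewrite summxE; apply: eq_bigr => d _.
  rewrite [LHS]mxE [X in _ * X]mxE mulr_sumr; apply: eq_bigr => e _.
  by rewrite nabla_cov1E mulrA.
rewrite /killing !N [X in _ + X]exchange_big -big_split mulr_sumr.
apply: eq_bigr => d _ /=; rewrite -big_split mulr_sumr; apply: eq_bigr =>
    e _ /=.
ring.
Qed.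

End change_of_coordinates.

(** * The operators on an open subset of R^n *)

Section local_operators.
Variables (R : realType) (n : nat) (U : set 'rV[R]_n).
Hypothesis oU : open U.
Variable g : comp2 R n.
Hypotheses (sg : smooth2 U g) (gsym : sym2 U g).
Hypothesis gunit : forall x, U x -> gram g x \in unitmx.

Let sG a : msmooth U (conn g a) := msmooth_conn oU sg gsym gunit a.

Lemma dricci_ext h h' b d x : (forall a b x, U x -> h a b x = h' a b x) ->
  U x -> dricci g h b d x = dricci g h' b d x.
Proof.
move=> hh Ux; have gh y : U y -> gram h y = gram h' y.
  by move=> Uy; apply/matrixP => i j; rewrite !mxE hh.
have sh a y : U y -> dconn_low g h a y = dconn_low g h' a y.
  move=> Uy; apply: koszul_ext => e; exact: (covd_ext oU).
have ZZ a : dcurv_low g h a b x = dcurv_low g h' a b x.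
  by rewrite /dcurv_low (covd_ext oU _ a Ux (sh b)) (covd_ext oU _ b Ux (sh a)).
by rewrite /dricci; apply: eq_bigr => a _; rewrite ZZ.
Qed.

Lemma smooth_dricci h b d : smooth2 U h -> smooth_on U (dricci g h b d).
Proof.
move=> sh; have sS a := msmooth_dconn_low oU sg gsym gunit sh a.
apply: smooth_sum => // a.
suff /(_ d a) : msmooth U (fun x => dcurv_low g h a b x *m invmx (gram g x)) by
    [].
apply: (msmoothM oU); last by apply: (msmooth_inv oU) => //;
    exact: msmooth_gram.
apply: (msmoothD oU); first exact: msmooth_covd.
by apply: (msmoothN oU); exact: msmooth_covd.
Qed.

Lemma smooth_killing X a b : (forall e, smooth_on U (X e)) ->
  smooth_on U (killing g X a b).
Proof.
move=> sX; have sC : msmooth U (fun y => \col_c X c y).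
  by move=> i j; apply: smooth_ext (sX i) => // y _; rewrite mxE.
have sN c d : smooth_on U (nabla_cov1 g X c d).
  have : msmooth U (fun x => mpd c (fun y => \col_e X e y) x
                             - conn g c x *m \col_e X e x).
    apply: (msmoothD oU); first exact: msmooth_mpd.
    by apply: (msmoothN oU); exact: (msmoothM oU).
  by move=> /(_ d 0); apply: smooth_ext => // y _; rewrite nabla_cov1E.
apply: (smoothM oU); first exact: smooth_cst.
by apply: (smoothD oU).
Qed.

(** The Calabi operator is unchanged when the pairs ab and cd are exchanged. *)
Lemma calabi_trace_sym h b d x : sym2 U h -> U x ->
  calabi_trace g h b d x = calabi_trace g h d b x.
Proof.
move=> hsym Ux.
have T a c e f : nabla_cov3 g (nabla_cov2 g h) a c e f x =
                 nabla_cov3 g (nabla_cov2 g h) a c f e x.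
  have sK k y : U y -> (covd (conn g) k (gram h) y)^T =
      covd (conn g) k (gram h) y.
    by move=> Uy; apply: (covdT oU) => // z Uz; exact: gramT hsym Uz.
  have sKK : (covd (conn g) a (covd (conn g) c (gram h)) x)^T =
     covd (conn g) a (covd (conn g) c (gram h)) x.
    by apply: (covdT oU) => // y; exact: sK.
  rewrite !nabla_cov3E -{1}sKK mxE; congr (_ - _); apply: eq_bigr => k _.
  by rewrite -{1}(sK k x Ux) mxE.
have S1 a c e f : hess_sym g h a c e f x = hess_sym g h c a e f x.
  by rewrite /hess_sym addrC.
have S2 a c e f : hess_sym g h a c e f x = hess_sym g h a c f e x.
  by rewrite /hess_sym (T a c) (T c a).
have CC a c : calabi g h a b c d x = calabi g h c d a b x.
  rewrite /calabi (S1 c a d b) (S2 a c d b) (S1 d a c b) (S2 a d c b).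
  rewrite (S1 c b d a) (S2 b c d a) (S1 d b c a) (S2 b d c a); ring.
have Isym a c : ginv g a c x = ginv g c a x.
  rewrite /ginv -{1}[invmx _]trmxK trmx_inv (gramT gsym Ux); exact: mxE.
rewrite /calabi_trace exchange_big; apply: eq_bigr => a _; apply: eq_bigr =>
    c _ /=.
by rewrite Isym CC.
Qed.

Lemma raise_lower (X : comp1 R n) (Y : comp1 R n) :
  (forall e x, U x -> Y e x = 2^-1 * \sum_b ginv g e b x * X b x) ->
  forall b x, U x -> X b x = 2 * \sum_c g b c x * Y c x.
Proof.
move=> YX b x Ux; pose C := \col_c X c x.
have -> : X b x = (gram g x *m (invmx (gram g x) *m C)) b 0.
  by rewrite mulmxA mulmxV ?gunit// mul1mx mxE.
rewrite mxE mulr_sumr; apply: eq_bigr => c _; rewrite YX// [gram g x b c]mxE.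
have -> : (invmx (gram g x) *m C) c 0 = \sum_e ginv g c e x * X e x.
  by rewrite mxE; apply: eq_bigr => e _; rewrite [C _ _]mxE.
by rewrite mulrCA [X in _ = _ * X]mulrA mulfV ?mul1r// pnatr_eq0.
Qed.

Section einstein.
Variable lam : R.
Hypothesis ein : forall b d x, U x -> ricci g b d x = lam * g b d x.

Lemma calabi_trace_zero h b d x : smooth2 U h -> sym2 U h -> U x ->
  (calabi_trace g h b d x = 0) <-> (dricci g h b d x = lam * h b d x).
Proof.
move=> sh hsym Ux.
rewrite (calabi_trace_dricci oU sg gsym gunit sh hsym Ux (fun b d =>
    ein b d Ux)).
split=> [/eqP|->]; last by rewrite subrr mulr0.
by rewrite mulf_eq0 oppr_eq0 pnatr_eq0 /= subr_eq0 => /eqP.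
Qed.

Lemma smooth_calabi_trace h b d : smooth2 U h -> sym2 U h ->
  smooth_on U (calabi_trace g h b d).
Proof.
move=> sh hsym; have : smooth_on U (fun x =>
    (-2) * (dricci g h b d x + (- lam) * h b d x)).
  apply: (smoothM oU); first exact: smooth_cst.
  apply: (smoothD oU); first exact: smooth_dricci.
  by apply: (smoothM oU); [exact: smooth_cst|exact: sh].
apply: smooth_ext => // x Ux.
by rewrite (calabi_trace_dricci oU sg gsym gunit sh hsym Ux (fun b d =>
    ein b d Ux)) -mulNr.
Qed.

Lemma calabi_trace_killing X b d x : (forall e, smooth_on U (X e)) -> U x ->
  calabi_trace g (killing g X) b d x = 0.
Proof.
move=> sX Ux; pose Y e x := 2^-1 * \sum_b ginv g e b x * X b x.
have sY e : smooth_on U (Y e).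
  apply: (smoothM oU); first exact: smooth_cst.
  apply: smooth_sum => // c; apply: (smoothM oU) => //.
  by have := msmooth_inv oU (msmooth_gram sg) gunit; apply.
have kl := killing_lie oU sg gsym gunit sY (raise_lower (Y :=
    Y) (fun e y _ => erefl)).
have sk : smooth2 U (killing g X) by move=> i j; exact: smooth_killing.
have ks : sym2 U (killing g X) by move=> i j y _; rewrite /killing addrC.
apply/(calabi_trace_zero b d sk ks Ux).
rewrite (dricci_ext b d kl Ux) kl//.
exact: (dricci_lie_einstein oU sg gsym gunit sY b d ein).
Qed.

End einstein.
End local_operators.

(** * Tensor fields on the manifold *)

Section manifold.
Variables (R : realType) (n : nat) (M : topologicalType).
Variable A : smooth_atlas R n M.
Implicit Types (c d : chart R n M) (x : 'rV[R]_n).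

Lemma open_overlap c d : open (overlap c d).
Proof.
rewrite openE => x [cx dx]; rewrite /interior.
have n1 : nbhs x (target c) by apply: open_nbhs_nbhs; split => //;
    exact: chart_target_open.
have n2 : nbhs (chart_inv c x) (source d).
  by apply: open_nbhs_nbhs; split => //; exact: chart_source_open.
have n3 : nbhs x (chart_inv c @^-1` source d) by exact: (chart_inv_continuous
    cx n2).
exact: filterI n1 n3.
Qed.

Lemma transition_target c d x : overlap c d x -> target d (transition c d x).
Proof. by move=> [_ dx]; exists (chart_inv c x). Qed.

Lemma chart_invK c x : target c x -> c (chart_inv c x) = x.
Proof. by move=> [p sp <-]; rewrite chart_mapK. Qed.

Lemma source_inv c x : target c x -> source c (chart_inv c x).
Proof. by move=> [p sp <-]; rewrite chart_mapK. Qed.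

Lemma transition_overlap c d x : overlap c d x ->
    overlap d c (transition c d x).
Proof.
move=> [cx dx]; split; first exact: transition_target.
by rewrite /transition chart_mapK//; exact: source_inv.
Qed.

Lemma transitionK c d x : overlap c d x ->
  transition d c (transition c d x) = x.
Proof.
by move=> [cx dx]; rewrite /transition chart_mapK// chart_invK.
Qed.

Lemma pd_coord (a b : 'I_n) x : pd a (fun y => y 0 b) x = (a == b)%:R.
Proof.
have := @derive_mx R 'rV[R]_n 1 n id x 'e_a (@derivable_id _ _ x 'e_a).
rewrite derive_id => /matrixP/(_ 0 b); rewrite !mxE eqxx /= => E.
by rewrite eq_sym E.
Qed.

(** The chain rule applied to the two mutually inverse transition maps. *)
Lemma jac_unit c d x : charts A c -> charts A d -> overlap c d x ->
  jacm (transition c d) x \in unitmx.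
Proof.
move=> Ac Ad ox.
suff : jacm (transition c d) x *m jacm (transition d c) (transition c d x) =
    1%:M.
  by move=> /mulmx1_unit[].
apply/matrixP => a b; rewrite [RHS]mxE -(pd_coord a b x).
have := pd_ext a (@open_overlap c d) ox
  (fun y oy => congr1 (fun z : 'rV[R]_n => z 0 b) (transitionK oy)).
move=> <-.
have [|_ ->] := derivable_pd_comp (psi := transition c d) (a :=
    a) (@open_overlap d c)
  (charts_compatible Ad Ac b) (transition_overlap ox).
  by move=> e; exact: smooth_derivable (charts_compatible Ac Ad e) ox.
by rewrite mxE; apply: eq_bigr => e _; rewrite !jacmE.
Qed.

Lemma conj_entry (J N : 'M[R]_n) a b : (J *m N *m J^T) a b =
  \sum_a' \sum_b' J a a' * J b b' * N a' b'.
Proof.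
rewrite mxE exchange_big; apply: eq_bigr => b' _.
rewrite !mxE mulr_suml; apply: eq_bigr => a' _; ring.
Qed.

Lemma sym2_field_gram (h : field2 R n M) c d x : sym2_field A h ->
  charts A c -> charts A d -> overlap c d x ->
  gram (h c) x = jacm (transition c d) x *m gram (h d) (transition c d x)
                 *m (jacm (transition c d) x)^T.
Proof.
move=> [_ _ th] Ac Ad ox; apply/matrixP => a b.
rewrite conj_entry mxE (th c d Ac Ad a b x ox).
by apply: eq_bigr => a' _; apply: eq_bigr => b' _;
    rewrite !jacmE [gram _ _ _ _]mxE.
Qed.

Variable g : field2 R n M.
Hypothesis gm : semi_riemannian A g.

Let sg c : charts A c -> smooth2 (target c) (g c).
Proof. by move: gm => [[s0 _ _] _] Ac a b; exact: s0. Qed.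

Let gsym c : charts A c -> sym2 (target c) (g c).
Proof. by move: gm => [[_ s0 _] _] Ac a b x; exact: s0. Qed.

Let gunit c : charts A c -> forall x, target c x -> gram (g c) x \in unitmx.
Proof. by move: gm => [_ ug] Ac; exact: ug. Qed.

Let gJ c d : charts A c -> charts A d -> forall x, overlap c d x ->
  gram (g c) x = jacm (transition c d) x *m gram (g d) (transition c d x)
                 *m (jacm (transition c d) x)^T.
Proof. by move=> Ac Ad x; apply: sym2_field_gram => //; exact: gm.1. Qed.

Let ot c : open (target c). Proof. exact: chart_target_open. Qed.

Let oc c d : overlap c d `<=` target c. Proof. by move=> x []. Qed.

Definition raise (X : field1 R n M) : field1 R n M := fun c e x =>
  2^-1 * \sum_b ginv (g c) e b x * X c b x.

Definition lower (Y : field1 R n M) : field1 R n M := fun c b x =>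
  2 * \sum_e g c b e x * Y c e x.

Let col (X : field1 R n M) c x : 'cV[R]_n := \col_b X c b x.

Lemma covector_col X c d x : covector_field A X -> charts A c -> charts A d ->
  overlap c d x -> col X c x = jacm (transition c d) x *m col X d (transition c
      d x).
Proof.
move=> [_ tX] Ac Ad ox; apply/colP => a; rewrite !mxE (tX c d Ac Ad a x ox).
by apply: eq_bigr => b _; rewrite jacmE [col _ _ _ _ _]mxE.
Qed.

Lemma vector_col Y c d x : vector_field A Y -> charts A c -> charts A d ->
  overlap c d x -> col Y d (transition c d x) =
      (jacm (transition c d) x)^T *m col Y c x.
Proof.
move=> [_ tY] Ac Ad ox; apply/colP => b; rewrite !mxE (tY c d Ac Ad b x ox).
by apply: eq_bigr => a _; rewrite [(jacm _ _)^T _ _]mxE jacmE [col _ _ _ _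
    _]mxE mulrC.
Qed.

Lemma raise_col X c x : col (raise X) c x =
    2^-1 *: (invmx (gram (g c) x) *m col X c x).
Proof.
apply/colP => e; rewrite !mxE; congr (_ * _).
by apply: eq_bigr => b _; rewrite [col _ _ _ _ _]mxE.
Qed.

Lemma lower_col Y c x : col (lower Y) c x = 2 *: (gram (g c) x *m col Y c x).
Proof.
apply/colP => e; rewrite !mxE; congr (_ * _).
by apply: eq_bigr => b _; rewrite [col _ _ _ _ _]mxE [gram _ _ _ _]mxE.
Qed.

Lemma colE X c b x : X c b x = col X c x b 0.
Proof. by rewrite mxE. Qed.

Lemma vector_field_raise X : covector_field A X -> vector_field A (raise X).
Proof.
move=> fX; have [sX _] := fX; split=> [c Ac a|c d Ac Ad b x ox].
  apply: (smoothM (@ot c)); first exact: smooth_cst.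
  apply: smooth_sum => // b; apply: (smoothM (@ot c)); last exact: sX.
  by have := msmooth_inv (@ot c) (msmooth_gram (sg Ac)) (gunit Ac); apply.
set J := jacm (transition c d) x; set y := transition c d x.

have inv := invgram_pullback (@transition_target c d)
  (fun x ox => jac_unit Ac Ad ox) (fun x ox => gunit Ac (oc ox)) (gunit Ad)
  (gJ Ac Ad) ox.
have -> : \sum_a raise X c a x * jac c d a b x = (J^T *m col (raise X) c x) b 0.
  rewrite mxE; apply: eq_bigr => a _.
  by rewrite [J^T _ _]mxE jacmE [col _ _ _ _ _]mxE mulrC.
rewrite colE raise_col raise_col -scalemxAr (covector_col fX Ac Ad ox) mulmxA
    inv.
by rewrite -mulmxA (mulmxA (invmx _) (jacm _ _)) mulVmx ?mul1mx// (jac_unit Ac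
    Ad).
Qed.

Lemma covector_field_lower Y : vector_field A Y -> covector_field A (lower Y).
Proof.
move=> fY; have [sY _] := fY; split=> [c Ac a|c d Ac Ad a x ox].
  apply: (smoothM (@ot c)); first exact: smooth_cst.
  apply: smooth_sum => // b; apply: (smoothM (@ot c)); last exact: sY.
  exact: sg.
set J := jacm (transition c d) x; set y := transition c d x.
have -> : \sum_b jac c d a b x * lower Y d b y = (J *m col (lower Y) d y) a 0.
  by rewrite mxE; apply: eq_bigr => b _; rewrite jacmE [col _ _ _ _ _]mxE.
rewrite colE !lower_col -scalemxAr (vector_col fY Ac Ad ox) (gJ Ac Ad ox).
by rewrite !mulmxA.
Qed.

Lemma killing_raise X c a b x : covector_field A X -> charts A c ->
    target c x ->
  killing (g c) (X c) a b x = lie_deriv (raise X c) (g c) a b x.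
Proof.
move=> fX Ac tx; have [sY _] := vector_field_raise fX.
apply: (killing_lie (@ot c) (sg Ac) (gsym Ac) (gunit Ac) (sY c Ac) _ _ _ tx).
by apply: (raise_lower (gunit Ac)) => e y _.
Qed.

Lemma killing_lower Y c a b x : vector_field A Y -> charts A c -> target c x ->
  killing (g c) (lower Y c) a b x = lie_deriv (Y c) (g c) a b x.
Proof.
move=> [sY _] Ac tx.
by apply: (killing_lie (@ot c) (sg Ac) (gsym Ac) (gunit Ac) (sY c Ac) _ _ _ tx).
Qed.

Lemma sym2_field_killing X : covector_field A X ->
    sym2_field A (killing_op g X).
Proof.
move=> [sX tX]; split.
- move=> c Ac a b; apply: (smooth_killing (@ot c) (sg Ac) (gsym Ac) (gunit Ac)).
  exact: sX.
- by move=> c Ac a b x _; rewrite /killing_op /killing addrC.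
- move=> c d Ac Ad a b x ox; rewrite /killing_op.
  have tX' b' y : overlap c d y ->
      X c b' y = \sum_e jacm (transition c d) y b' e * X d e (transition c d y).
    by move=> oy; rewrite (tX c d Ac Ad b' y oy); apply: eq_bigr => e _;
        rewrite jacmE.
  rewrite (killing_pullback (@open_overlap c d) (@ot d)
    (charts_compatible Ac Ad) (@transition_target c d)
    (fun x ox => jac_unit Ac Ad ox) (fun i j x ox => gsym Ac i j (oc ox))
    (fun x ox => gunit Ac (oc ox)) (sg Ad) (gsym Ad) (gunit Ad) (gJ Ac Ad)
    a b (sX d Ad) tX' ox).
  by apply: eq_bigr => i _; apply: eq_bigr => j _; rewrite !jacmE.
Qed.

Variable lam : R.
Hypothesis ein : einstein A g lam.

Let einc c : charts A c -> forall (i j : 'I_n) x, target c x ->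
  ricci (g c) i j x = lam * g c i j x.
Proof. by move=> Ac i j x; exact: ein. Qed.

Lemma sym2_field_P h : sym2_field A h -> sym2_field A (P_op g h).
Proof.
move=> fh; have [sh hsym th] := fh; split.
- move=> c Ac a b.
  exact: (smooth_calabi_trace (@ot c) (sg Ac) (gsym Ac) (gunit Ac) (einc Ac) _ _
    (sh c Ac) (hsym c Ac)).
- move=> c Ac a b x tx.
  exact: (calabi_trace_sym (@ot c) (gsym Ac) _ _ (hsym c Ac) tx).
- move=> c d Ac Ad a b x ox; rewrite /P_op; have ty := transition_target ox.
  rewrite (calabi_trace_dricci (@ot c) (sg Ac) (gsym Ac) (gunit Ac) (sh c Ac)
    (hsym c Ac) (oc ox) (fun i j => einc Ac i j (oc ox))).
  rewrite (dricci_pullback (@open_overlap c d) (@ot d)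
    (charts_compatible Ac Ad) (@transition_target c d)
    (fun x ox => jac_unit Ac Ad ox) (fun i j x ox => gsym Ac i j (oc ox))
    (fun x ox => gunit Ac (oc ox)) (sg Ad) (gsym Ad) (gunit Ad) (gJ Ac Ad)
    (sh d Ad) (hsym d Ad) (fun x ox => sym2_field_gram fh Ac Ad ox) a b ox).
  rewrite (th c d Ac Ad a b x ox) mulr_sumr -sumrB mulr_sumr.
  apply: eq_bigr => i _; rewrite mulr_sumr -sumrB mulr_sumr;
      apply: eq_bigr => j _.
  rewrite (calabi_trace_dricci (@ot d) (sg Ad) (gsym Ad) (gunit Ad) (sh d Ad)
    (hsym d Ad) ty (fun i j => einc Ad i j ty)) !jacmE.
  rewrite -/(jac c d a i x) -/(jac c d b j x).
  move: (dricci _ _ _ _ _) (h d i j _) (jac c d a i x) (jac c d b j x) =>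
      u v s t.
  ring.
Qed.

Lemma P_killing X : covector_field A X ->
  eq_field2 A (P_op g (killing_op g X)) (@zero_field2 R n M).
Proof.
move=> [sX _] c Ac a b x tx.
exact: (calabi_trace_killing (@ot c) (sg Ac) (gsym Ac) (gunit Ac) (einc Ac) a b
  (sX c Ac) tx).
Qed.

Lemma P_kernel h : sym2_field A h ->
  eq_field2 A (P_op g h) (@zero_field2 R n M) <->
  einstein_to_first_order A g h lam.
Proof.
move=> [sh hsym _].
have lin c (Ac : charts A c) := einstein_first_order_dricci (@ot c) (sg Ac)
    (gsym Ac)
  (gunit Ac) (sh c Ac) (hsym c Ac) (einc Ac).
have zero c (Ac : charts A c) i j x (tx : target c x) :=
    calabi_trace_zero (@ot c)
  (sg Ac) (gsym Ac) (gunit Ac) (einc Ac) i j (sh c Ac) (hsym c Ac) tx.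
split=> [P0 c Ac x0 tx0 a b|E c Ac a b x tx].
  apply: (lin c Ac).1 => // i j x tx; exact: ((zero c Ac i j x tx).1 (P0 c Ac i
      j x tx)).
apply: ((zero c Ac a b x tx).2 ((lin c Ac).2 _ a b x tx)).
exact: E.
Qed.

Lemma killing_range h :
  (exists2 X, covector_field A X & eq_field2 A h (killing_op g X)) <->
  (exists2 Y, vector_field A Y & eq_field2 A h (lie_op Y g)).
Proof.
split=> [[X fX hX]|[Y fY hY]].
  exists (raise X); first exact: vector_field_raise.
  by move=> c Ac a b x tx; rewrite hX// /killing_op killing_raise.
exists (lower Y); first exact: covector_field_lower.
by move=> c Ac a b x tx; rewrite hY// /killing_op killing_lower.
Qed.

End manifold.

Theorem theorem1 (R : realType) (n : nat) (M : topologicalType)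
    (hausdorffM : hausdorff_space M) (second_countableM : @second_countable M)
    (A : smooth_atlas R n M) (g : field2 R n M) (lam : R)
    (g_metric : semi_riemannian A g) (g_einstein : einstein A g lam) :
  [/\ (* (i) *)
      [/\ forall X, covector_field A X -> sym2_field A (killing_op g X),
          forall h, sym2_field A h -> sym2_field A (P_op g h)
        & forall X, covector_field A X ->
            eq_field2 A (P_op g (killing_op g X)) (@zero_field2 R n M)],
      (* (ii) *)
      forall h, sym2_field A h ->
        (eq_field2 A (P_op g h) (@zero_field2 R n M) <->
         einstein_to_first_order A g h lam)
    & (* (iii) *)
      forall h, sym2_field A h ->
        ((exists2 X, covector_field A X & eq_field2 A h (killing_op g X)) <->
         (exists2 Y, vector_field A Y & eq_field2 A h (lie_op Y g)))].
Proof.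
split.
- split.
  + by move=> X; exact: sym2_field_killing.
  + by move=> h; exact: (sym2_field_P g_metric g_einstein).
  + by move=> X; exact: (P_killing g_metric g_einstein).
- by move=> h; exact: (P_kernel g_metric g_einstein).
- by move=> h _; exact: killing_range.
Qed.
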